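(* Let $\pi\colon E\to\mathbb{R}$ be a fibre bundle, $L\in C^\infty(J^1\pi)$ a Lagrangian admitting a Hamiltonian section, and $G\in C^\infty(J^1\pi^* )$ a first class function. Then: (1) The following two conditions are equivalent, and if they hold then $Y_G$ is a dynamical symmetry: (a) for every Hamiltonian section $h$ for $L$ with $X_h$ tangent to $S_H^f$, $\{\mu^*G,h^\star\}_{T^*E}\equiv\mathbf{pfcc}$ on $\tilde S_H^f$; (b) $\{\mu^*G,h_0^\star\}_{T^*E}\equiv\mathbf{pfcc}$ on $\tilde S_H^f$ and $\{\mu^*G,\mathbf{pfcc}\}_{T^*E}\equiv\mathbf{pfcc}$ on $\tilde S_H^f$, where $h_0$ is a Hamiltonian section for $L$ such that $X_{h_0}$ is tangent to $S_H^f$. (2) Let $h_0$ be a Hamiltonian section for $L$ such that $X_{h_0}$ is tangent to $S_H^1$ (at the points of $S_H^2$). Then $\{\mu^*G,h_0^\star\}_{T^*E}=0$ on $\tilde S_H^2$ and $\{\mu^*G,\mathbf{pfcc}^1\}_{T^*E}=0$ on $\tilde S_H^2$ if and only if $G$ generates a Hamiltonian (Noether) symmetry. Here $\{\mu^*G,h^\star\}_{T^*E}\equiv\mathbf{pfcc}$ means that there is a $\mathbf{pfcc}$ function $\phi$ such that $\{\mu^*G,h^\star\}_{T^*E}-\mu^*\phi$ vanishes strongly on $\tilde S_H^f$; $\{\mu^*G,\mathbf{pfcc}\}_{T^*E}\equiv\mathbf{pfcc}$ means that for every $\mathbf{pfcc}$ function $\phi$ there is a $\mathbf{pfcc}$ function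 $\phi'$ such that $\{\mu^*G,\mu^*\phi\}_{T^*E}-\mu^*\phi'$ vanishes strongly on $\tilde S_H^f$; and $\{\mu^*G,\mathbf{pfcc}^1\}_{T^*E}=0$ on $\tilde S_H^2$ means $\{\mu^*G,\mu^*\phi\}_{T^*E}=0$ on $\tilde S_H^2$ for every $\mathbf{pfcc}^1$ function $\phi$.
   Context: Bundles. $\pi\colon E\to\mathbb{R}$ is a fibre bundle, $t$ the coordinate on $\mathbb{R}$, $(t,q^\alpha)$ fibred coordinates on $E$, $(t,q^\alpha,v^\alpha)$ on $J^1\pi$. $J^1\pi^*=\operatorname{Ver}(\pi)^*$ is the dual of the vertical bundle, coordinates $(t,q^\alpha,p_\alpha)$; $T^*E$ has coordinates $(t,q^\alpha,u,p_\alpha)$ and $\mu\colon T^*E\to J^1\pi^*$ is restriction to vertical vectors. $\{\,,\}_{T^*E}$ is the canonical bracket ($\{q^\alpha,p_\beta\}=\delta^\alpha_\beta$, $\{t,u\}=1$); $\{\,,\}$ on $J^1\pi^*$ is the bracket making $\mu$ Poisson, $\{f,g\}=\frac{\partial f}{\partial q^\alpha}\frac{\partial g}{\partial p_\alpha}-\frac{\partial f}{\partial p_\alpha}\frac{\partial g}{\partial q^\alpha}$, and $Y_g=\{\,\cdot\,,g\}$ is the Hamiltonian vector field on $J^1\pi^*$ of $g$. Legendre maps. $\mathcal{F}_L(t,q,v)=(t,q^\alpha,\partial L/\partial v^\alpha)\in J^1\pi^*$, $\widehat{\mathcal F}_L(t,q,v)=(t,q^\alpha,-E_L,\partial L/\partial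 v^\alpha)\in T^*E$, $E_L=v^\alpha\frac{\partial L}{\partial v^\alpha}-L$. Hamiltonian sections. A Hamiltonian section for $L$ is a section $h$ of $\mu$ with $\widehat{\mathcal F}_L=h\circ\mathcal{F}_L$ (assumed to exist); locally $h(t,q,p)=(t,q,-H,p)$, and $h^\star\in C^\infty(T^*E)$ is defined by $\alpha-h(\mu(\alpha))=h^\star(\alpha)\,dt$, locally $h^\star=u+H$. $X_h$ is the vector field on $J^1\pi^*$ with $\mu^*(X_hf)=\{\mu^*f,h^\star\}_{T^*E}$, locally $X_h=\frac{\partial}{\partial t}+\frac{\partial H}{\partial p_\alpha}\frac{\partial}{\partial q^\alpha}-\frac{\partial H}{\partial q^\alpha}\frac{\partial}{\partial p_\alpha}$. Given one Hamiltonian section $h_c$ and a complete set $\{\phi_I\}$ of independent primary constraints (functions defining $S_H^1$), the Hamiltonian sections for $L$ are $h=h_c+\lambda^I\phi_I$ with $\lambda^I$ functions on $J^1\pi^*$, where $h'=h+g$ means $h'{}^\star=h^\star+\mu^*g$, and then $X_{h'}=X_h+Y_g$. Constraint algorithm. $S_H^1=\mathcal{F}_L(J^1\pi)$; $S_H^{k+1}$ is the set of points of $S_H^k$ at which $X_h$ is tangent to $S_H^k$ for some Hamiltonian section $h$ for $L$; the sequence stabilizes at the final constraint manifold $S_H^f$. All these sets are assumed to be submanifolds, and the matrices of Poisson brackets of constraints and $\mathcal{F}_L$ to have constant rank. $\tilde S_H^k=\mu^{-1}(S_H^k)$, $\tilde S_H^f=\mu^{-1}(S_H^f)$. ''Tangent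 to $S_H^f$'' refers to points of $S_H^f$. First class. A function $g\in C^\infty(J^1\pi^* )$ is first class if $\{g,\phi\}=0$ on $S_H^f$ for every function $\phi$ vanishing on $S_H^f$. A $\mathbf{pfcc}$ function is a primary constraint (a function on $J^1\pi^*$ vanishing on $S_H^1$) that is first class in this sense. A $\mathbf{pfcc}^1$ function is a primary constraint $\phi$ with $\{\phi,\psi\}=0$ on $S_H^1$ for every primary constraint $\psi$. Strong vanishing. A function $f$ vanishes strongly on a submanifold $S$ (written $f\equiv0$) if $f$ and the full differential $df$ vanish at every point of $S$. Symmetries. Let $\{\phi_a\}$ be a complete set of independent $\mathbf{pfcc}$ functions and $X_{h_0}$ tangent to $S_H^f$; the solutions of the dynamics on $S_H^f$ are $\Gamma=X_{h_0}+\alpha^aY_{\phi_a}$ with $\alpha^a$ arbitrary functions. A dynamical symmetry is a vector field $Y$ on $J^1\pi^*$, tangent to $S_H^f$, such that for every such $\Gamma$ there are functions $\beta^a\in C^\infty(J^1\pi^* )$ with $[Y,\Gamma]=\beta^aY_{\phi_a}$ on $S_H^f$. A function $G$ generates a Hamiltonian (Noether) symmetry if $\{\mu^*G,h^\star\}_{T^*E}=0$ on $\tilde S_H^2$ for every Hamiltonian section $h$ for $L$ such that $X_h$ is tangent to $S_H^1$ (at the points of $S_H^2$, where this is possible). *)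

(* Defs.v *)
From mathcomp Require Import all_boot all_order all_algebra.
From mathcomp Require Import all_classical all_reals all_analysis.

Set Implicit Arguments.
Unset Strict Implicit.
Unset Printing Implicit Defensive.

Import Order.TTheory GRing.Theory Num.Theory.
Import numFieldNormedType.Exports.
Local Open Scope classical_set_scope.
Local Open Scope ring_scope.

Fixpoint diff_upto (R : realType) (V : normedModType R) (k : nat) (U : set V)
    (f : V -> R) : Prop :=
  (forall x, U x -> differentiable f x) /\
  (if k is k'.+1 then forall v : V, diff_upto k' U ('D_v f) else True).

(* On a finite-dimensional V and an open U this is C^oo: all iterated
   directional derivatives exist and are (Frechet) differentiable on U. *)
Definition smooth (R : realType) (V : normedModType R) (U : set V)
  (f : V -> R) : Prop := forall k, diff_upto k U f.

(* A set with an atlas; the topology is the one generated by the atlas (see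
   [mopen]), so none is postulated on the carrier. [unchart i] is the inverse of
   [chart i] on the image of [dom i], and [chart_at x] is a preferred chart
   around x. *)
Record charted_space (R : realType) (N : nat) := ChartedSpace {
  pt :> Type;
  idx : Type;
  dom : idx -> set pt;
  chart : idx -> pt -> 'rV[R]_N;
  unchart : idx -> 'rV[R]_N -> pt;
  chart_at : pt -> idx }.

Arguments dom {R N} c.
Arguments chart {R N} c.
Arguments unchart {R N} c.
Arguments chart_at {R N} c.

Definition mopen (R : realType) (N : nat) (M : charted_space R N)
    (A : set M) : Prop :=
  forall i : idx M, open (chart M i @` (dom M i `&` A)).

Definition smooth_map_on (R : realType) (N N' : nat) (M : charted_space R N)
    (M' : charted_space R N') (A : set M) (F : M -> M') : Prop :=
  forall (i : idx M) (j : idx M'),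
    let W := chart M i @` (dom M i `&` A `&` F @^-1` (dom M' j)) in
    open W /\
    forall k, smooth W (fun x => chart M' j (F (unchart M i x)) 0 k).

Definition smooth_map (R : realType) (N N' : nat) (M : charted_space R N)
  (M' : charted_space R N') (F : M -> M') : Prop := smooth_map_on setT F.

Definition smooth_fun (R : realType) (N : nat) (M : charted_space R N)
    (f : M -> R) : Prop :=
  forall i : idx M, smooth (chart M i @` dom M i) (f \o unchart M i).

Record is_manifold (R : realType) (N : nat) (M : charted_space R N) : Prop :=
  IsManifold {
    mf_chart_at : forall x : M, dom M (chart_at M x) x;
    mf_chartK : forall i (x : M), dom M i x -> unchart M i (chart M i x) = x;
    mf_open : forall i j, open (chart M i @` (dom M i `&` dom M j));
    mf_transition : forall i j k,
      smooth (chart M i @` (dom M i `&` dom M j))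
             (fun x => chart M j (unchart M i x) 0 k);
    mf_hausdorff : forall x y : M, x <> y -> exists A B : set M,
      [/\ mopen A, mopen B, A x, B y & A `&` B = set0];
    mf_second_countable : exists B : nat -> set M,
      (forall k, mopen (B k)) /\
      (forall (A : set M) x, mopen A -> A x -> exists k, B k x /\ B k `<=` A) }.

Definition euclid (R : realType) (N : nat) : charted_space R N :=
  @ChartedSpace R N 'rV[R]_N unit (fun _ => setT) (fun _ => id) (fun _ => id)
    (fun _ => tt).

Definition line_times (R : realType) (n : nat) (F : charted_space R n) :
    charted_space R (1 + n) :=
  @ChartedSpace R (1 + n) (R * F)%type (idx F)
    (fun j z => dom F j z.2)
    (fun j z => row_mx (z.1)%:M (chart F j z.2))
    (fun j x => (lsubmx x 0 0, unchart F j (rsubmx x)))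
    (fun z => chart_at F z.2).

(* df_x(v), for v given by its components in the preferred chart at x. *)
Definition ddir (R : realType) (N : nat) (M : charted_space R N)
    (f : M -> R) (x : M) (v : 'rV[R]_N) : R :=
  'D_v (f \o unchart M (chart_at M x)) (chart M (chart_at M x) x).

Definition partial (R : realType) (N : nat) (M : charted_space R N)
    (k : 'I_N) (f : M -> R) (x : M) : R :=
  ddir f x (delta_mx 0 k).

Definition map_rank (R : realType) (N N' : nat) (M : charted_space R N)
    (M' : charted_space R N') (F : M -> M') (x : M) : nat :=
  \rank ('J (chart M' (chart_at M' (F x)) \o F \o unchart M (chart_at M x))
            (chart M (chart_at M x) x)).

(* Embedded submanifolds, by slice charts. *)
Definition is_submanifold (R : realType) (N : nat) (M : charted_space R N)
    (S : set M) : Prop :=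
  exists d : nat, (d <= N)%N /\
  forall z, S z ->
  exists (U : set M) (psi : M -> euclid R N) (psi' : euclid R N -> M),
    [/\ mopen U /\ U z,
        forall x, U x -> psi' (psi x) = x,
        smooth_map_on U psi,
        smooth_map_on (psi @` U) psi' /\ open (psi @` U : set 'rV[R]_N) &
        forall x, U x ->
          (S x <-> forall k : 'I_N, (d <= k)%N -> (psi x : 'rV[R]_N) 0 k = 0)].

(* Vector fields act as derivations of the algebra of smooth functions; the
   value of an operator on non-smooth functions is irrelevant. *)
Record is_vector_field (R : realType) (N : nat) (M : charted_space R N)
    (X : (M -> R) -> M -> R) : Prop := IsVectorField {
  vf_smooth : forall f, smooth_fun f -> smooth_fun (X f);
  vf_linear : forall (a : R) f g, smooth_fun f -> smooth_fun g ->
    X (fun x => a * f x + g x) = (fun x => a * X f x + X g x);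
  vf_leibniz : forall f g, smooth_fun f -> smooth_fun g ->
    X (fun x => f x * g x) = (fun x => X f x * g x + f x * X g x) }.

Definition lie_bracket (R : realType) (N : nat) (M : charted_space R N)
    (X Y : (M -> R) -> M -> R) : (M -> R) -> M -> R :=
  fun f x => X (Y f) x - Y (X f) x.

(* X_z is the velocity at z of a smooth curve lying in S. *)
Definition tangent_at (R : realType) (N : nat) (M : charted_space R N)
    (S : set M) (X : (M -> R) -> M -> R) (z : M) : Prop :=
  exists (c : R -> M) (e : R),
    [/\ 0 < e, c 0 = z,
        forall s, `|s| < e -> dom M (chart_at M z) (c s) /\ S (c s),
        forall k, smooth [set s : R | `|s| < e]
                    (fun s => chart M (chart_at M z) (c s) 0 k) &
        forall f, smooth_fun f -> is_derive (0 : R) 1 (f \o c) (X f z)].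

Definition vanishes_on (R : realType) (T : Type) (S : set T) (f : T -> R) :
  Prop := forall z, S z -> f z = 0.

Definition strongly_vanishes_on (R : realType) (N : nat)
    (M : charted_space R N) (S : set M) (f : M -> R) : Prop :=
  forall z, S z -> f z = 0 /\ forall v, ddir f z v = 0.

Definition independent_on (R : realType) (N : nat) (M : charted_space R N)
    (m : nat) (S : set M) (phi : 'I_m -> M -> R) : Prop :=
  forall z, S z -> row_free (\matrix_(a < m, k < N) partial k (phi a) z).

(* Completeness is meant globally: every function vanishing on S is a
   combination of the phi_a with smooth functions as coefficients. *)
Record complete_constraints (R : realType) (N : nat) (M : charted_space R N)
    (m : nat) (S : set M) (phi : 'I_m -> M -> R) : Prop :=
  CompleteConstraints {
    cc_smooth : forall a, smooth_fun (phi a);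
    cc_zeros : S = [set z | forall a, phi a z = 0];
    cc_indep : independent_on S phi;
    cc_complete : forall psi, smooth_fun psi -> vanishes_on S psi ->
      exists lam : 'I_m -> M -> R, (forall a, smooth_fun (lam a)) /\
        psi = (fun z => \sum_(a < m) lam a z * phi a z) }.

(* The atlas of the total space consists of fibred charts (t, q), so that dt has
   components (1, 0) and vertical vectors are the (0, w) in each of them. *)
Record fibre_bundle (R : realType) (n : nat) := FibreBundle {
  total :> charted_space R (1 + n);
  fibre : charted_space R n;
  proj : total -> R;
  fb_total : is_manifold total;
  fb_fibre : is_manifold fibre;
  fb_fibred : forall i e, dom total i e ->
    chart total i e 0 (lshift n ord0) = proj e;
  fb_trivial : forall t0 : R,
    exists (I : set R) (theta : total -> line_times fibre)
           (eta : line_times fibre -> total),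
      [/\ open I /\ I t0,
          forall e, I (proj e) -> (theta e).1 = proj e /\ eta (theta e) = e,
          forall z : line_times fibre, I z.1 ->
            proj (eta z) = z.1 /\ theta (eta z) = z,
          smooth_map_on [set e | I (proj e)] theta &
          smooth_map_on [set z : line_times fibre | I z.1] eta] }.

Section Bundle.
Context {R : realType} {n : nat} (E : fibre_bundle R n).
Local Notation N := (1 + n)%N.

(* Jacobian at e of the change of coordinates from chart i to chart j; row
   convention: a tangent vector v at e transforms as v_j = v_i *m change i j e,
   hence a covector as p_i = p_j *m (change i j e)^T. *)
Definition change (i j : idx E) (e : E) : 'M[R]_N :=
  'J (chart E j \o unchart E i) (chart E i e).

(* Its restriction to vertical vectors: the block dq_j / dq_i. *)
Definition vchange (i j : idx E) (e : E) : 'M[R]_n :=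
  drsubmx (change i j e).

(* In the three bundles below a point is stored with its components in the
   preferred chart of E at its base point. *)

(* Coordinates (t, q, v). A 1-jet is identified with a tangent vector (1, v)
   at e projecting to d/dt. *)
Definition J1 : charted_space R (N + n) :=
  @ChartedSpace R (N + n) (E * 'rV[R]_n)%type (idx E)
    (fun i z => dom E i z.1)
    (fun i z => row_mx (chart E i z.1)
       (rsubmx (row_mx (1%:M : 'M[R]_1) z.2 *m change (chart_at E z.1) i z.1)))
    (fun i x => let e := unchart E i (lsubmx x) in
       (e, rsubmx (row_mx (1%:M : 'M[R]_1) (rsubmx x)
                     *m change i (chart_at E e) e)))
    (fun z => chart_at E z.1).

(* The dual of the vertical bundle, coordinates (t, q, p). *)
Definition J1d : charted_space R (N + n) :=
  @ChartedSpace R (N + n) (E * 'rV[R]_n)%type (idx E)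
    (fun i z => dom E i z.1)
    (fun i z => row_mx (chart E i z.1)
       (z.2 *m (vchange i (chart_at E z.1) z.1)^T))
    (fun i x => let e := unchart E i (lsubmx x) in
       (e, rsubmx x *m (vchange (chart_at E e) i e)^T))
    (fun z => chart_at E z.1).

(* The cotangent bundle of E, coordinates (t, q, u, p). *)
Definition TE : charted_space R (N + N) :=
  @ChartedSpace R (N + N) (E * 'rV[R]_N)%type (idx E)
    (fun i z => dom E i z.1)
    (fun i z => row_mx (chart E i z.1)
       (z.2 *m (change i (chart_at E z.1) z.1)^T))
    (fun i x => let e := unchart E i (lsubmx x) in
       (e, rsubmx x *m (change (chart_at E e) i e)^T))
    (fun z => chart_at E z.1).

Definition mu (a : TE) : J1d := (a.1, rsubmx (a.2 : 'rV[R]_(1 + n))).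

(* Canonical bracket: {q, p} = {t, u} = 1. *)
Definition brT (f g : TE -> R) (a : TE) : R :=
  \sum_(k < N) (partial (lshift N k) f a * partial (rshift N k) g a
              - partial (rshift N k) f a * partial (lshift N k) g a).

Definition brJ (f g : J1d -> R) (z : J1d) : R :=
  \sum_(k < n)
    (partial (lshift n (rshift 1 k)) f z * partial (rshift N k) g z
   - partial (rshift N k) f z * partial (lshift n (rshift 1 k)) g z).

Definition ham_vf (g : J1d -> R) : (J1d -> R) -> J1d -> R :=
  fun f => brJ f g.

Definition fibre_grad (L : J1 -> R) (z : J1) : 'rV[R]_n :=
  \row_(k < n) 'D_(delta_mx 0 k) (fun w : 'rV[R]_n => L (z.1, w)) z.2.

Definition energy (L : J1 -> R) (z : J1) : R :=
  \sum_(k < n) (z.2 : 'rV[R]_n) 0 k * fibre_grad L z 0 k - L z.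

Definition FL (L : J1 -> R) (z : J1) : J1d := (z.1, fibre_grad L z).

Definition FLhat (L : J1 -> R) (z : J1) : TE :=
  (z.1, row_mx (- energy L z)%:M (fibre_grad L z)).

Record ham_section (L : J1 -> R) (h : J1d -> TE) : Prop := HamSection {
  hs_smooth : smooth_map h;
  hs_section : forall z, mu (h z) = z;
  hs_legendre : forall z, FLhat L z = h (FL L z) }.

(* alpha - h (mu alpha) = hstar h alpha * dt, and dt has components (1, 0). *)
Definition hstar (h : J1d -> TE) (a : TE) : R :=
  lsubmx ((a.2 - (h (mu a)).2) : 'rV[R]_(1 + n)) 0 0.

(* mu^* (X_h f) = {mu^* f, hstar h}: the right-hand side is constant along the
   fibres of mu, and is evaluated at the point h z of the fibre over z. *)
Definition Xh (h : J1d -> TE) : (J1d -> R) -> J1d -> R :=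
  fun f z => brT (f \o mu) (hstar h) (h z).

(* SH L k is S_H^k for k >= 1; SH L 0 is the whole space. *)
Fixpoint SH (L : J1 -> R) (k : nat) : set J1d :=
  match k with
  | 0 => setT
  | k'.+1 =>
    if k' is 0 then range (FL L)
    else [set z | SH L k' z /\
           exists h, ham_section L h /\ tangent_at (SH L k') (Xh h) z]
  end.

Definition first_class (Sf : set J1d) (g : J1d -> R) : Prop :=
  forall phi, smooth_fun phi -> vanishes_on Sf phi ->
    vanishes_on Sf (brJ g phi).

Definition primary (L : J1 -> R) (phi : J1d -> R) : Prop :=
  smooth_fun phi /\ vanishes_on (SH L 1) phi.

Definition pfcc (L : J1 -> R) (Sf : set J1d) (phi : J1d -> R) : Prop :=
  primary L phi /\ first_class Sf phi.

Definition pfcc1 (L : J1 -> R) (phi : J1d -> R) : Prop :=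
  primary L phi /\
  forall psi, primary L psi -> vanishes_on (SH L 1) (brJ phi psi).

Definition equiv_pfcc (L : J1 -> R) (Sf : set J1d) (F : TE -> R) : Prop :=
  exists phi, pfcc L Sf phi /\
    strongly_vanishes_on (mu @^-1` Sf) (fun a => F a - phi (mu a)).

(* Completeness is modulo functions vanishing strongly on Sf, which generate
   the zero Hamiltonian vector field on Sf. *)
Record complete_pfcc (L : J1 -> R) (Sf : set J1d) (l : nat)
    (phi : 'I_l -> J1d -> R) : Prop := CompletePfcc {
  cp_pfcc : forall a, pfcc L Sf (phi a);
  cp_indep : independent_on Sf phi;
  cp_complete : forall psi, pfcc L Sf psi ->
    exists lam : 'I_l -> J1d -> R, (forall a, smooth_fun (lam a)) /\
      strongly_vanishes_on Sf
        (fun z => psi z - \sum_(a < l) lam a z * phi a z) }.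

Definition dynamics (h0 : J1d -> TE) (l : nat) (phi : 'I_l -> J1d -> R)
    (alpha : 'I_l -> J1d -> R) : (J1d -> R) -> J1d -> R :=
  fun f z => Xh h0 f z + \sum_(a < l) alpha a z * ham_vf (phi a) f z.

Definition dynamical_symmetry (Sf : set J1d) (h0 : J1d -> TE) (l : nat)
    (phi : 'I_l -> J1d -> R) (Y : (J1d -> R) -> J1d -> R) : Prop :=
  [/\ is_vector_field Y,
      forall z, Sf z -> tangent_at Sf Y z &
      forall alpha, (forall a, smooth_fun (alpha a)) ->
      exists beta : 'I_l -> J1d -> R, (forall a, smooth_fun (beta a)) /\
        forall f, smooth_fun f -> forall z, Sf z ->
          lie_bracket Y (dynamics h0 phi alpha) f z
          = \sum_(a < l) beta a z * ham_vf (phi a) f z].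

Definition noether_symmetry (L : J1 -> R) (G : J1d -> R) : Prop :=
  forall h, ham_section L h ->
    (forall z, SH L 2 z -> tangent_at (SH L 1) (Xh h) z) ->
    vanishes_on (mu @^-1` SH L 2) (brT (G \o mu) (hstar h)).

End Bundle.

(* Main.v *)
Require Import Defs.
From mathcomp Require Import all_boot all_order all_algebra.
From mathcomp Require Import all_classical all_reals all_analysis.
From mathcomp Require Import ring lra.
Import Order.TTheory GRing.Theory Num.Theory.
Import numFieldNormedType.Exports.
Set Implicit Arguments.
Unset Strict Implicit.
Unset Printing Implicit Defensive.
Local Open Scope classical_set_scope.
Local Open Scope ring_scope.

(** The theorem is Poisson algebra on T^*E and on J^1pi^*, together with two facts
    that connect this algebra with sections and with tangency.

    Sections. Two Hamiltonian sections differ by a function times dt, and this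
    function vanishes on S_H^1 because both sections send F_L to the same extended
    Legendre map: it is a primary constraint psi, with h'^* = h^* + mu^*psi and
    X_h' = X_h + Y_psi. Conversely a section may be shifted by any primary
    constraint ([ham_diff], [ham_shift_section], [Xh_add]).

    Tangency. A vector field is tangent to a submanifold S at z exactly when it kills
    at z the functions that vanish on S ([tangent_kills], [tangent_of_kills]). So if
    X_h0 is tangent to S_H^f, then X_(h0 + psi) is tangent to S_H^f if and only if
    the primary constraint psi is first class. The sections of condition (a) are
    therefore the h0 + psi with psi a pfcc function, and (a) and (b) are exchanged by
    adding and subtracting brackets ([equiv_pfcc_all_sections]).

    Symmetry. By the Jacobi identity [Y_G, X_h0] f = - {f, {G, h0^*}} and
    [Y_G, Y_chi] f = - {f, {G, chi}}. Replacing a function by a strongly equivalent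
    one does not change its brackets on S_H^f, so under (b) the inner brackets may be
    replaced by pfcc functions, then by combinations of the complete set chi, whose
    members vanish on S_H^f: both commutators are combinations of the Y_chi there
    ([dynamical_symmetry_ham_vf]).

    Noether symmetries. The same argument works along S_H^2, with one gap: if X_h and
    X_h0 are tangent to S_H^1 at the points of S_H^2, then psi = h - h0 commutes with
    the primary constraints on S_H^2 only, whereas a pfcc^1 function does so on all of
    S_H^1. Write psi as a combination of the phi_I with coefficients lambda^I. At a
    point z of S_H^2 the vector lambda(z) is in the kernel of the matrix
    ({phi_I, phi_J})(z). This matrix has constant rank on S_H^1, so
    lambda(z) extends to a smooth kappa that stays in the kernel along S_H^1
    ([kernel_extension]); the combination of the phi_I with coefficients kappa^I is
    pfcc^1 and has at z the same bracket with G as psi ([noether_condition]).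

    The analysis is there to make this algebra legitimate. The brackets are defined
    at each point in the preferred chart of that point, so already their smoothness
    requires independence of the chart: the transition maps of T^*E are cotangent
    lifts, and these are symplectic because second derivatives commute
    ([derive_sym], [cotangent_lift], [brT_chart]). The statements about J^1pi^* are
    read off on T^*E through the pullback by mu ([brT_mu], [smooth_of_mu],
    [brT_hstar]). Tangency is tested by global functions, so local slice coordinates
    have to be cut off by bump functions, whose extension by zero is smooth because
    the total space is Hausdorff ([smooth_extension]). *)

(** * Germs of differentiable functions *)

Lemma differentiable_near0 (R : realType) (V W : normedModType R)
    (h : V -> W) (x : V) :
  (\forall y \near x, h y = 0) -> differentiable h x.
Proof.
move=> h0.
have H : h \o shift x = cst (h x) + \0 +o_ 0 id.
  apply/eqaddoE; rewrite funeqE => y /=.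
  have hx : h x = 0 by exact: nbhs_singleton h0.
  rewrite !fctE hx !add0r littleoE; first by [].
  move=> _/posnumP[eps].
  have h0' : \forall z \near (0 : V), h (z + x) = 0.
    by have := h0; rewrite (near_shift 0 x); apply: filterS => z /=; rewrite subr0.
  by apply: filterS h0' => z /= ->; rewrite normr0 mulr_ge0.
apply/diff_locallyP; rewrite (@diff_unique _ _ _ h \0)//; first by split => //; exact: cst_continuous.
exact: cst_continuous.
Qed.

(** Differentiability is a property of the germ: the difference of two functions with
    the same germ is differentiable by [differentiable_near0]. *)
Lemma differentiable_near (R : realType) (V W : normedModType R)
    (f g : V -> W) (x : V) :
  (\forall y \near x, f y = g y) -> differentiable f x -> differentiable g x.
Proof.
move=> fg df.
have -> : g = f + (g - f) by rewrite addrC subrK.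
apply: (differentiableD df); apply: differentiable_near0.
by apply: filterS fg => y /= fgy; rewrite !fctE /= fgy subrr.
Qed.

(** * Closure properties of smooth functions on open sets *)

Section Smooth.
Context {R : realType} {V : normedModType R}.
Implicit Types (U W : set V) (f g : V -> R) (k : nat).

(** [diff_upto] only speaks of the values of iterated derivatives at the points of U.
    Smoothness is thus a pointwise condition, which is what makes gluing and
    restriction immediate; openness of U matters only to compute derivatives. *)
Lemma diff_uptoP k U f :
  diff_upto k U f <-> forall x, U x -> diff_upto k [set x] f.
Proof.
elim: k f => [|k IH] f /=.
  split=> [[d _] x Ux|H]; first by split=> // y ->; exact: d.
  by split=> // x Ux; have [+ _] := H x Ux; exact.
split=> [[d D] x Ux|H].
  split=> [y -> |v]; first exact: d.
  exact: (IH _).1 (D v) x Ux.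
split=> [x Ux|v]; first by have [+ _] := H x Ux; exact.
by apply/IH => x Ux; have [_ +] := H x Ux; exact.
Qed.

Lemma smoothP U f : smooth U f <-> forall x, U x -> smooth [set x] f.
Proof.
split=> [H x Ux k|H k]; first exact: (diff_uptoP k U f).1 (H k) x Ux.
by apply/diff_uptoP => x Ux; exact: H.
Qed.

Lemma smooth_sub U W f : U `<=` W -> smooth W f -> smooth U f.
Proof. by move=> UW /smoothP H; apply/smoothP => x /UW; exact: H. Qed.

Lemma diff_upto_near k x f g : (\forall y \near x, f y = g y) ->
  diff_upto k [set x] f -> diff_upto k [set x] g.
Proof.
elim: k f g => [|k IH] f g fg /= [d D]; split.
- by move=> y ->; apply: differentiable_near fg _; exact: d.
- by [].
- by move=> y ->; apply: differentiable_near fg _; exact: d.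
- move=> v; apply: (IH ('D_v f)) => //.
  by apply: filterS (nbhs_interior fg) => y; exact: near_eq_derive.
Qed.

Lemma smooth_near x f g : (\forall y \near x, f y = g y) ->
  smooth [set x] f -> smooth [set x] g.
Proof. by move=> fg H k; exact: diff_upto_near fg (H k). Qed.

Lemma smooth_eq U f g : open U -> {in U, f =1 g} -> smooth U f -> smooth U g.
Proof.
move=> oU fg /smoothP H; apply/smoothP => x Ux; apply: smooth_near (H x Ux).
by apply: filterS (open_nbhs_nbhs (conj oU Ux)) => y Uy; apply: fg; rewrite inE.
Qed.

Lemma diff_upto_eq k U f g : open U -> {in U, f =1 g} ->
  diff_upto k U f -> diff_upto k U g.
Proof.
move=> oU fg /diff_uptoP H; apply/diff_uptoP => x Ux.
apply: diff_upto_near (H x Ux).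
by apply: filterS (open_nbhs_nbhs (conj oU Ux)) => y Uy; apply: fg; rewrite inE.
Qed.

Lemma diff_uptoW k U f : diff_upto k.+1 U f -> diff_upto k U f.
Proof.
elim: k f => [|k IH] f /= [d D]; split=> // v; apply: IH; exact: D.
Qed.

Lemma smooth_diff U f x : smooth U f -> U x -> differentiable f x.
Proof. by move=> /(_ 0%N)[+ _]; exact. Qed.

Lemma smooth_derive U f v : smooth U f -> smooth U ('D_v f).
Proof. by move=> H k; case: (H k.+1) => _; exact. Qed.

Lemma diff_upto_cst k U (c : R) : open U -> diff_upto k U (fun=> c).
Proof.
move=> oU; elim: k c => [|k IH] c.
  by split=> // x _; exact: differentiable_cst.
split=> [x _|v]; first exact: differentiable_cst.
by apply: (diff_upto_eq oU _ (IH 0)) => x _; rewrite derive_cst.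
Qed.

Lemma smooth_cst U (c : R) : open U -> smooth U (fun=> c).
Proof. by move=> oU k; exact: diff_upto_cst. Qed.

Lemma diff_uptoD k U f g : open U -> diff_upto k U f -> diff_upto k U g ->
  diff_upto k U (fun x => f x + g x).
Proof.
move=> oU; elim: k f g => [|k IH] f g sf sg /=.
  by split=> // x Ux; apply: differentiableD; [exact: sf.1|exact: sg.1].
have [[df Df] [dg Dg]] := (sf, sg).
split=> [x Ux|v]; first by apply: differentiableD; [exact: df|exact: dg].
apply: (diff_upto_eq oU _ (IH _ _ (Df v) (Dg v))) => x; rewrite inE => Ux.
by rewrite [RHS](@deriveD _ _ _ f g)//; [exact/diff_derivable/df|exact/diff_derivable/dg].
Qed.

Lemma smoothD U f g : open U -> smooth U f -> smooth U g ->
  smooth U (fun x => f x + g x).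
Proof. by move=> oU sf sg k; exact: diff_uptoD. Qed.

Lemma diff_uptoM k U f g : open U -> diff_upto k U f -> diff_upto k U g ->
  diff_upto k U (fun x => f x * g x).
Proof.
move=> oU; elim: k f g => [|k IH] f g sf sg.
  by split=> // x Ux; apply: differentiableM; [exact: sf.1|exact: sg.1].
have [[df Df] [dg Dg]] := (sf, sg).
split=> [x Ux|v]; first by apply: differentiableM; [exact: df|exact: dg].
apply: (diff_upto_eq oU _ (diff_uptoD oU (IH _ _ (diff_uptoW sf) (Dg v))
   (IH _ _ (Df v) (diff_uptoW sg)))) => x; rewrite inE => Ux.
rewrite [RHS](@deriveM _ _ f g); [|exact/diff_derivable/df|exact/diff_derivable/dg].
by congr (_ + _); rewrite mulrC.
Qed.

Lemma smoothM U f g : open U -> smooth U f -> smooth U g ->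
  smooth U (fun x => f x * g x).
Proof. by move=> oU sf sg k; exact: diff_uptoM. Qed.

Lemma smoothZ U (c : R) f : open U -> smooth U f -> smooth U (fun x => c * f x).
Proof. by move=> oU; apply: smoothM => //; exact: smooth_cst. Qed.

Lemma smoothN U f : open U -> smooth U f -> smooth U (fun x => - f x).
Proof.
move=> oU sf; apply: (smooth_eq oU _ (smoothZ (-1) oU sf)) => x _.
by rewrite mulN1r.
Qed.

Lemma smoothB U f g : open U -> smooth U f -> smooth U g ->
  smooth U (fun x => f x - g x).
Proof. by move=> oU sf sg; apply: smoothD => //; exact: smoothN. Qed.

Lemma diff_upto_sum k U (I : Type) (s : seq I) (P : pred I) (F : I -> V -> R) :
  open U -> (forall i, P i -> diff_upto k U (F i)) ->
  diff_upto k U (fun x => \sum_(i <- s | P i) F i x).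
Proof.
move=> oU H; rewrite (_ : (fun x => _) = \sum_(i <- s | P i) F i); last first.
  by apply/funext => x; rewrite fct_sumE.
elim/big_ind : _ => [|f g sf sg|i Pi]; last exact: H.
  exact: diff_upto_cst.
exact: diff_uptoD.
Qed.

Lemma smooth_sum U (I : Type) (s : seq I) (P : pred I) (F : I -> V -> R) :
  open U -> (forall i, P i -> smooth U (F i)) ->
  smooth U (fun x => \sum_(i <- s | P i) F i x).
Proof. by move=> oU H k; apply: diff_upto_sum => // i Pi; exact: H. Qed.

Lemma smooth_prod U (I : Type) (s : seq I) (P : pred I) (F : I -> V -> R) :
  open U -> (forall i, P i -> smooth U (F i)) ->
  smooth U (fun x => \prod_(i <- s | P i) F i x).
Proof.
move=> oU H; rewrite (_ : (fun x => _) = \prod_(i <- s | P i) F i); last first.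
  by apply/funext => x; rewrite fct_prodE.
elim/big_ind : _ => [|f g sf sg|i Pi]; last exact: H.
  exact: smooth_cst.
exact: smoothM.
Qed.

End Smooth.

(** * Chain rule, gradients and symmetry of second derivatives *)

Section Chain.
Context {R : realType}.

Lemma derive_comp (U V W : normedModType R) (T : U -> V) (f : V -> W) x v :
  differentiable T x -> differentiable f (T x) ->
  'D_v (f \o T) x = 'D_('D_v T x) f (T x).
Proof.
move=> dT df; rewrite !deriveE//; last exact: differentiable_comp.
by rewrite diff_comp.
Qed.

Lemma differentiable_rV (V : normedModType R) n (T : V -> 'rV[R]_n) x :
  (forall k, differentiable (fun y => T y 0 k) x) -> differentiable T x.
Proof.
move=> H.
rewrite (_ : T = \sum_(k < n) (fun y => T y 0 k *: delta_mx 0 k)); last first.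
  by apply/funext => y; rewrite fct_sumE -row_sum_delta.
by apply: differentiable_sum => k; apply: differentiableZl.
Qed.

Lemma differentiable_comp_coord (V : normedModType R) n (T : V -> 'rV[R]_n) x k :
  differentiable T x -> differentiable (fun y => T y 0 k) x.
Proof.
move=> H; apply: (@differentiable_comp _ _ _ _ T (fun z : 'rV[R]_n => z 0 k)) => //.
exact: differentiable_coord.
Qed.

Lemma derive_coord (V : normedModType R) n (T : V -> 'rV[R]_n) x v k :
  differentiable T x -> ('D_v T x) 0 k = 'D_v (fun y => T y 0 k) x.
Proof. by move=> H; rewrite derive_mx ?mxE//; exact: diff_derivable. Qed.

Definition grad n (f : 'rV[R]_n -> R) (x : 'rV[R]_n) : 'rV[R]_n :=
  \row_k 'D_(delta_mx 0 k) f x.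

Lemma derive_grad n (f : 'rV[R]_n -> R) x v : differentiable f x ->
  'D_v f x = \sum_k v 0 k * 'D_(delta_mx 0 k) f x.
Proof.
move=> df; rewrite deriveE// [in LHS](row_sum_delta v) raddf_sum/=.
by apply: eq_bigr => k _; rewrite linearZ/= -deriveE.
Qed.

Lemma derive_gradE n (f : 'rV[R]_n -> R) x v : differentiable f x ->
  'D_v f x = (v *m (grad f x)^T) 0 0.
Proof.
by move=> df; rewrite derive_grad// mxE; apply: eq_bigr => k _; rewrite !mxE.
Qed.

(** Induction on k: by the chain rule the derivative of f o T is a sum of products of
    functions covered by the induction hypothesis and of derivatives of T. *)
Lemma diff_upto_comp (V : normedModType R) n k (W : set V) (U : set 'rV[R]_n)
    (f : 'rV[R]_n -> R) (T : V -> 'rV[R]_n) :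
  open W -> (forall x, W x -> U (T x)) -> diff_upto k U f ->
  (forall j, smooth W (fun x => T x 0 j)) -> diff_upto k W (f \o T).
Proof.
move=> oW WU + sT; have dT x : W x -> differentiable T x.
  by move=> Wx; apply: differentiable_rV => j; exact: smooth_diff (sT j) Wx.
elim: k f => [|k IH] f [df Df].
  split=> // x Wx; apply: differentiable_comp; first exact: dT.
  by apply/df/WU.
split=> [x Wx|v].
  apply: differentiable_comp; first exact: dT.
  by apply/df/WU.
have H : diff_upto k W (fun x => \sum_(j < n)
    ('D_v (fun y => T y 0 j) x * ('D_(delta_mx 0 j) f \o T) x)).
  apply: diff_upto_sum => // j _; apply: diff_uptoM => //.
    exact: smooth_derive (sT j) k.
  exact/IH/Df.
apply: (diff_upto_eq oW _ H) => x; rewrite inE => Wx.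
rewrite [RHS]derive_comp; [|exact: dT|by apply/df/WU].
rewrite derive_grad; last by apply/df/WU.
by apply: eq_bigr => j _; rewrite derive_coord//; exact: dT.
Qed.

Lemma smooth_comp (V : normedModType R) n (W : set V) (U : set 'rV[R]_n)
    (f : 'rV[R]_n -> R) (T : V -> 'rV[R]_n) :
  open W -> (forall x, W x -> U (T x)) -> smooth U f ->
  (forall j, smooth W (fun x => T x 0 j)) -> smooth W (f \o T).
Proof. by move=> oW WU sf sT k; exact: diff_upto_comp (sf k) sT. Qed.

Lemma smooth_coord n (W : set 'rV[R]_n) k : open W ->
  smooth W (fun x : 'rV[R]_n => x 0 k).
Proof.
move=> oW [|d]; first by split=> // x _; exact: differentiable_coord.
split=> [x _|v]; first exact: differentiable_coord.
apply: (diff_upto_eq oW _ (@diff_upto_cst _ _ d W (v 0 k) oW)) => x _.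
by rewrite -[RHS](@derive_coord _ _ id x v k) ?derive_id.
Qed.

End Chain.

Section Schwarz.
Context {R : realType} {V : normedModType R}.

Lemma differentiable_eps (f : V -> R) x (e : R) : 0 < e -> differentiable f x ->
  exists2 d, 0 < d & forall h, `|h| < d ->
    `|f (h + x) - f x - 'D_h f x| <= e * `|h|.
Proof.
move=> e0 df; have /eqaddoP/(_ _ e0)/nbhs_ballP[d /= d0 H] := diff_locally df.
exists d => // h hd; rewrite deriveE//.
have := H h; rewrite /= !fctE /= opprD addrA; apply.
by rewrite -ball_normE /= sub0r normrN.
Qed.

Lemma is_derive_line (f : V -> R) a v (s : R) : differentiable f (a + s *: v) ->
  is_derive s 1 (fun t : R => f (a + t *: v)) ('D_v f (a + s *: v)).
Proof.
move=> df; pose T (t : R) := a + t *: v.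
have dT : is_diff s T (fun t => 0 + t *: v) by apply: is_diffD.
have dT' : differentiable T s by exact: ex_diff.
apply: DeriveDef; first exact/diff_derivable/(@differentiable_comp _ _ _ _ T f s dT' df).
rewrite (derive_comp _ dT' df).
by congr ('D_ _ f _); rewrite (deriveE _ dT') diff_val add0r scale1r.
Qed.

Lemma deriveDr (f : V -> R) x u v : differentiable f x ->
  'D_(u + v) f x = 'D_u f x + 'D_v f x.
Proof. by move=> df; rewrite !(deriveE _ df) raddfD. Qed.

Lemma deriveZr (f : V -> R) x (c : R) v : differentiable f x ->
  'D_(c *: v) f x = c * 'D_v f x.
Proof. by move=> df; rewrite !(deriveE _ df) linearZ. Qed.

(** Young's argument: the mean value theorem in the direction v turns the second
    difference into an increment of 'D_v f, which is expanded to first order at x. *)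
Lemma second_difference (W : set V) (f : V -> R) x v w (e : R) :
  open W -> W x -> (forall y, W y -> differentiable f y) ->
  differentiable ('D_v f) x -> 0 < e ->
  exists2 d, 0 < d & forall s, 0 < s < d ->
    `|f (x + s *: w + s *: v) - f (x + s *: v) - f (x + s *: w) + f x
      - s ^+ 2 * 'D_w ('D_v f) x| <= e * s ^+ 2.
Proof.
move=> oW Wx df dg e0; set g := 'D_v f.
(* With this M, every point x + b s w + t v with b <= 1 and t <= s is within
   s M of x; the error budget e / (2 M) is spent at two such points. *)
pose M := `|v| + `|w| + 1.
have M0 : 0 < M by rewrite ltr_wpDl// addr_ge0.
have e'0 : 0 < e / (2 * M) by rewrite divr_gt0// mulr_gt0.
have [d1 d10 Hd1] := differentiable_eps e'0 dg.
have /nbhs_ballP[d2 /= d20 Hd2] := open_nbhs_nbhs (conj oW Wx).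
exists (Num.min d1 d2 / M); first by rewrite divr_gt0// lt_min d10.
move=> s /andP[s0 sd].
have bnd t : 0 <= t <= s -> forall b, 0 <= b <= 1 ->
    `|b *: (s *: w) + t *: v| <= s * M /\ s * M < Num.min d1 d2.
  move=> /andP[t0 ts] b /andP[b0 b1]; split; last by rewrite -ltr_pdivlMr.
  apply: (le_trans (ler_normD _ _)); rewrite !normrZ !ger0_norm// ?(ltW s0)//.
  rewrite /M !mulrDr mulr1 addrC.
  have : t * `|v| <= s * `|v| by rewrite ler_wpM2r.
  have : b * (s * `|w|) <= s * `|w| by rewrite ler_piMl// mulr_ge0// ltW.
  by move: s0; lra.
have inW t b : 0 <= t <= s -> 0 <= b <= 1 -> W (x + b *: (s *: w) + t *: v).
  move=> ht hb; have [H1 H2] := bnd _ ht _ hb; apply: Hd2.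
  rewrite -ball_normE /= -addrA opprD addNKr normrN.
  by apply: (le_lt_trans H1); apply: (lt_le_trans H2); rewrite ge_min lexx orbT.
have in0 t : 0 <= t <= s -> W (x + t *: v).
  by move=> ht; have := @inW t 0 ht; rewrite scale0r addr0 lexx ler01; exact.
have in1 t : 0 <= t <= s -> W (x + s *: w + t *: v).
  by move=> ht; have := @inW t 1 ht; rewrite scale1r lexx ler01; exact.
pose phi (t : R) := f (x + s *: w + t *: v) - f (x + t *: v).
have dphi t : 0 <= t <= s ->
    is_derive t 1 phi (g (x + s *: w + t *: v) - g (x + t *: v)).
  move=> ht; apply: is_deriveB; apply: is_derive_line; apply: df.
    exact: in1.
  exact: in0.
(* The mean value theorem in the direction v alone: the second difference is
   s times an increment of 'D_v f in the direction w. *)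
have [|t||c] := @MVT R phi (fun t => g (x + s *: w + t *: v) - g (x + t *: v)) 0 s.
- by [].
- by rewrite in_itv/= => /andP[t0 ts]; apply: dphi; rewrite !ltW.
- apply: derivable_within_continuous => t; rewrite in_itv/= => ht.
  by have [] := dphi _ ht.
rewrite in_itv/= => /andP[c0 cs]; have hc : 0 <= c <= s by rewrite !ltW.
rewrite /phi !scale0r !addr0 subr0 => E.
have -> : f (x + s *: w + s *: v) - f (x + s *: v) - f (x + s *: w) + f x =
  (g (x + s *: w + c *: v) - g (x + c *: v)) * s by rewrite -E; ring.
have h01 : 0 <= (1 : R) <= 1 by rewrite lexx ler01.
have h00 : 0 <= (0 : R) <= 1 by rewrite lexx ler01.
have [A1 A2] := bnd _ hc _ h01; have [B1 B2] := bnd _ hc _ h00.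
rewrite scale1r in A1; rewrite scale0r add0r in B1.
have := Hd1 (s *: w + c *: v); have := Hd1 (c *: v).
rewrite deriveDr// !deriveZr// -/g.
set D := 'D_w g x; set D' := 'D_v g x.
have -> : s *: w + c *: v + x = x + s *: w + c *: v by rewrite addrC addrA.
rewrite [c *: v + x]addrC.
have lt1 y : y <= s * M -> y < d1.
  move=> H; apply: (le_lt_trans H); apply: (lt_le_trans A2).
  by rewrite ge_min lexx.
move=> /(_ (lt1 _ B1)) H1 /(_ (lt1 _ A1)) H2.
have K y : y <= s * M -> e / (2 * M) * y <= e * s / 2.
  move=> Hy; have : e / (2 * M) * y <= e / (2 * M) * (s * M) by rewrite ler_wpM2l// ltW.
  have -> : e / (2 * M) * (s * M) = e * s / 2 by field; rewrite gt_eqF.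
  by [].
have {}H1 := le_trans H1 (K _ B1); have {}H2 := le_trans H2 (K _ A1).
set p := g (x + s *: w + c *: v) in H2 *; set q := g (x + c *: v) in H1 *.
have -> : (p - q) * s - s ^+ 2 * D =
  ((p - g x - (s * D + c * D')) - (q - g x - c * D')) * s by ring.
rewrite normrM (gtr0_norm s0).
have -> : e * s ^+ 2 = (e * s) * s by ring.
rewrite ler_pM2r//; apply: (le_trans (ler_normB _ _)).
by rewrite [leRHS]splitr; apply: lerD.
Qed.

(** The second difference is symmetric in v and w, and [second_difference] identifies
    its leading term with either mixed derivative. *)
Lemma derive_sym (W : set V) (f : V -> R) x v w :
  open W -> W x -> smooth W f -> 'D_w ('D_v f) x = 'D_v ('D_w f) x.
Proof.
move=> oW Wx sf.
have df y : W y -> differentiable f y by exact: smooth_diff.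
have dv u : differentiable ('D_u f) x by apply: (smooth_diff (smooth_derive u sf)).
apply/eqP; rewrite eq_sym -subr_eq0 -normr_eq0 eq_le normr_ge0 andbT.
apply/ler_addgt0Pr => e e0; rewrite add0r; have e20 : 0 < e / 2 by rewrite divr_gt0.
have [d1 d10 H1] := second_difference w oW Wx df (dv v) e20.
have [d2 d20 H2] := second_difference v oW Wx df (dv w) e20.
pose s := Num.min d1 d2 / 2.
have d0 : 0 < Num.min d1 d2 by rewrite lt_min d10.
have s0 : 0 < s by rewrite divr_gt0.
have sd : s < Num.min d1 d2 by rewrite /s; move: d0; lra.
have {}H1 := H1 s; rewrite s0 (lt_le_trans sd) ?ge_min ?lexx// in H1.
have {}H2 := H2 s; rewrite s0 (lt_le_trans sd) ?ge_min ?lexx ?orbT// in H2.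
have {}H1 := H1 isT; have {}H2 := H2 isT.
have s20 : 0 < s ^+ 2 by rewrite exprn_gt0.
rewrite -(ler_pM2r s20) -[in leLHS](gtr0_norm s20) -normrM.
move: H1; rewrite (addrAC x (s *: w)); move: H2.
set a := f (x + _ + _); set b := f (x + s *: v); set c := f (x + s *: w).
set D := 'D_w _ _; set D' := 'D_v _ _ => H2 H1.
have -> : (D' - D) * s ^+ 2 = (a - b - c + f x - s ^+ 2 * D) -
  (a - c - b + f x - s ^+ 2 * D') by ring.
apply: (le_trans (ler_normB _ _)); apply: (le_trans (lerD H1 H2)).
by rewrite -mulrDl -splitr.
Qed.

End Schwarz.

(** * Bump functions *)

Section Bump.
Context {R : realType}.

(** The family is closed under differentiation up to linear combinations, so that all
    derivatives of exp (- 1/t) can be treated at once by induction. *)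
Definition flat_exp (n : nat) (t : R) : R :=
  if 0 < t then t^-1 ^+ n * expR (- t^-1) else 0.

(** A quadratic bound at 0, which makes the derivative at 0 exist and vanish. *)
Lemma flat_exp_le n t : `|flat_exp n t| <= n.+2`!%:R * t ^+ 2.
Proof.
rewrite /flat_exp; case: ifPn => [t0|_]; last first.
  by rewrite normr0 mulr_ge0// sqr_ge0.
have y0 : 0 < t^-1 by rewrite invr_gt0.
rewrite ger0_norm ?mulr_ge0 ?exprn_ge0 ?expR_ge0 ?(ltW y0)//.
rewrite expRN ler_pdivrMr ?expR_gt0//.
have := expR_ge1Dxn n.+1 (ltW y0).
set z := expR _ => H.
have fn0 : 0 < n.+2`!%:R :> R by rewrite ltr0n fact_gt0.
(* The term of degree n + 2 of the exponential series beats (1/t)^n by the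
   factor t^2. *)
have {}H : t^-1 ^+ n.+2 <= n.+2`!%:R * z.
  rewrite mulrC -ler_pdivrMr//; apply: le_trans H; rewrite lerDr//.
have -> : t^-1 ^+ n = t ^+ 2 * t^-1 ^+ n.+2.
  by rewrite !exprS expr0; field; rewrite gt_eqF.
by rewrite [leRHS]mulrAC [leRHS]mulrC ler_wpM2l ?sqr_ge0.
Qed.

Lemma is_derive_flat_exp (n : nat) (t : R) :
  is_derive t 1 (flat_exp n) (flat_exp n.+2 t - n%:R * flat_exp n.+1 t).
Proof.
have [t0|t0|->] := ltgtP t 0.
- have -> : flat_exp n.+2 t - n%:R * flat_exp n.+1 t = 0.
    by rewrite /flat_exp ltNge (ltW t0)/= mulr0 subr0.
  apply: near_eq_is_derive (is_derive_cst (0 : R) t 1).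
  near=> s; rewrite /flat_exp ifF//; apply/negbTE; rewrite -leNgt ltW//.
  by near: s; exact: lt_nbhsl.
- have H : is_derive t 1 (fun s => s^-1 ^+ n * expR (- s^-1))
     (flat_exp n.+2 t - n%:R * flat_exp n.+1 t).
    have Di : is_derive t 1 (fun s : R => s^-1) (- t ^- 2).
      have := @is_deriveV R id t 1 1 _ (is_derive_id _ _).
      by rewrite gt_eqF// => /(_ isT); rewrite [_ *: _]mulr1.
    have De : is_derive t 1 (fun s : R => expR (- s^-1)) (expR (- t^-1) * - - t ^- 2).
      by apply: (@is_derive1_comp _ expR (fun s => - s^-1)).
    have Dn := @is_deriveX _ _ (fun s : R => s^-1) n t 1 _ Di.
    have := @is_deriveM _ _ _ _ _ _ _ _ Dn De.
    have -> : (fun s : R => s^-1) ^+ n * (fun s : R => expR (- s^-1)) =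
        (fun s => s^-1 ^+ n * expR (- s^-1)) by apply/funext => s; rewrite !fctE.
    move=> D; apply: (is_derive_eq D); rewrite !fctE.
    rewrite /flat_exp t0 /= /GRing.scale/= opprK.
    by case: n {Dn D} => [|n] /=; rewrite -!exprVn !exprS ?expr0; ring.
  apply: near_eq_is_derive H; near=> s; rewrite /flat_exp ifT//.
  by near: s; exact: lt_nbhsr.
- have -> : flat_exp n.+2 (0 : R) - n%:R * flat_exp n.+1 0 = 0.
    by rewrite /flat_exp ltxx mulr0 subr0.
  set C : R := n.+2`!%:R.
  suff H : (fun h : R => h^-1 *: (flat_exp n (h *: (1 : R) + 0) - flat_exp n 0)) @ 0^' --> (0 : R).
    by apply: DeriveDef; [apply/cvg_ex; exists 0|exact/cvg_lim].
  apply/cvgrPdist_le => /= e e0.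
  have C0 : 0 < C by rewrite ltr0n fact_gt0.
  near=> h; rewrite sub0r normrN /GRing.scale/= mulr1 addr0.
  have -> : flat_exp n 0 = 0 by rewrite /flat_exp ltxx.
  have h0 : h != 0 by near: h; exact: nbhs_dnbhs_neq.
  rewrite subr0 normrM normfV ler_pdivrMl ?normr_gt0//.
  apply: (le_trans (flat_exp_le n h)); rewrite -/C -real_normK ?num_real// expr2.
  rewrite mulrA mulrC ler_wpM2l ?normr_ge0// mulrC -ler_pdivlMr// ltW//.
  by near: h; apply: dnbhs0_lt; rewrite divr_gt0.
Unshelve. all: by end_near. Qed.

Lemma smooth_flat_exp n : smooth setT (flat_exp n).
Proof.
move=> k; elim: k n => [|k IH] n.
  by split=> // x _; apply/derivable1_diffP; have [] := is_derive_flat_exp n x.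
have dF x : differentiable (flat_exp n) x.
  by apply/derivable1_diffP; have [] := is_derive_flat_exp n x.
split=> // v.
have -> : 'D_v (flat_exp n) = fun x => v * (flat_exp n.+2 x + - n%:R * flat_exp n.+1 x).
  apply/funext => x; rewrite -[in LHS](mulr1 v) -[v * 1]/(v *: 1) deriveZr//.
  by rewrite (@derive_val _ _ _ _ _ _ _ (is_derive_flat_exp n x)) mulNr.
apply: diff_uptoM; [exact: openT|exact/diff_upto_cst/openT|].
apply: diff_uptoD; [exact: openT|exact: IH|].
by apply: diff_uptoM; [exact: openT|exact/diff_upto_cst/openT|exact: IH].
Qed.

End Bump.

(** * The canonical bracket in coordinates *)

Lemma derive_proj (R : realType) n (x v : 'rV[R]_n) k :
  'D_v (fun y : 'rV[R]_n => y 0 k) x = v 0 k.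
Proof. by rewrite -(@derive_coord _ _ _ id x v) ?derive_id. Qed.

Section BumpRV.
Context {R : realType}.

(** Supported in the cube of radius e around c: cubes are the balls of the norm of row
    vectors, and their compactness is a product of segments. *)
Definition bump n (c : 'rV[R]_n) (e : R) (x : 'rV[R]_n) : R :=
  \prod_(k < n) flat_exp 0 (e ^+ 2 - (x 0 k - c 0 k) ^+ 2).

Lemma smooth_comp1 (V : normedModType R) (W : set V) (f : R -> R) (T : V -> R) :
  open W -> smooth setT f -> smooth W T -> smooth W (f \o T).
Proof.
move=> oW sf sT.
have sT' : forall j, smooth W (fun x => ((T x)%:M : 'rV[R]_1) 0 j).
  by move=> j; apply: (smooth_eq oW _ sT) => x _; rewrite ord1 mxE eqxx mulr1n.
have := @smooth_comp R V 1 W setT (fun y => f (y 0 0)) (fun x => (T x)%:M : 'rV[R]_1) oW.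
have -> : (fun y : 'rV[R]_1 => f (y 0 0)) \o (fun x => (T x)%:M : 'rV[R]_1) = f \o T.
  by apply/funext => x /=; rewrite mxE eqxx mulr1n.
apply=> //.
move=> d; elim: d f sf => [|d IH] f sf.
  split=> // y _; apply: (@differentiable_comp _ _ _ _ (fun y : 'rV[R]_1 => y 0 0) f).
    exact: differentiable_coord.
  exact: smooth_diff sf _.
have dc y : differentiable (fun y : 'rV[R]_1 => y 0 0) y by exact: differentiable_coord.
have df y : differentiable f y by exact: smooth_diff sf _.
split=> [y _|v].
  exact: (@differentiable_comp _ _ _ _ (fun y : 'rV[R]_1 => y 0 0) f).
apply: (diff_upto_eq openT _ (IH _ (smooth_derive (v 0 0) sf))) => y _.
rewrite [RHS](@derive_comp _ _ _ _ (fun y : 'rV[R]_1 => y 0 0) f) //.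
by rewrite derive_proj.
Qed.

Lemma smooth_bump n (c : 'rV[R]_n) e : smooth setT (bump c e).
Proof.
apply: smooth_prod => [|k _]; first exact: openT.
apply: (@smooth_comp1 _ setT (flat_exp 0)); [exact: openT|exact: smooth_flat_exp|].
have sc : smooth setT (fun x : 'rV[R]_n => x 0 k - c 0 k).
  by apply: smoothB; [exact: openT|exact/smooth_coord/openT|exact/smooth_cst/openT].
apply: smoothB; [exact: openT|exact/smooth_cst/openT|].
by apply: smoothM; [exact: openT|exact: sc|exact: sc].
Qed.

Lemma bump_center n (c : 'rV[R]_n) e : 0 < e -> bump c e c != 0.
Proof.
move=> e0; apply/prodf_neq0 => k _.
by rewrite subrr expr0n subr0 /flat_exp exprn_gt0// expr0 mul1r gt_eqF// expR_gt0.
Qed.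

Lemma bump_supp n (c : 'rV[R]_n) e x : 0 < e -> bump c e x != 0 ->
  forall k, `|x 0 k - c 0 k| < e.
Proof.
move=> e0 /prodf_neq0 H k; have := H k isT; rewrite /flat_exp; case: ifPn; rewrite ?eqxx// => + _.
by rewrite subr_gt0 -[ltLHS]real_normK ?num_real// ltr_pXn2r// nnegrE ltW.
Qed.

Lemma compact_box n (c : 'rV[R]_n) (e : R) :
  compact [set x : 'rV[R]_n | forall k, `|x 0 k - c 0 k| <= e].
Proof.
have -> : [set x : 'rV[R]_n | forall k, `|x 0 k - c 0 k| <= e] =
    [set x | forall k, `[c 0 k - e, c 0 k + e]%classic (x ord0 k)].
  apply/seteqP; split=> x /= H k; have := H k; rewrite /= in_itv/= ler_distl//.
apply: (@rV_compact R n (fun k => `[c 0 k - e, c 0 k + e]%classic)) => k.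
exact: segment_compact.
Qed.

Lemma box_ball n (c x : 'rV[R]_n) (e d : R) : 0 <= e -> e < d ->
  (forall k, `|x 0 k - c 0 k| <= e) -> ball c d x.
Proof.
move=> e0 ed H; rewrite -ball_normE /=.
rewrite /Num.Def.normr/= mx_normrE; apply: le_lt_trans ed.
by apply/bigmax_leP; split=> // -[i k] _ /=; rewrite !mxE ord1 distrC.
Qed.

End BumpRV.

Section Bracket.
Context {R : realType}.

Lemma derive_bigsum (V : normedModType R) n (F : 'I_n -> V -> R) x v :
  (forall i, differentiable (F i) x) ->
  'D_v (fun y => \sum_(i < n) F i y) x = \sum_(i < n) 'D_v (F i) x.
Proof.
move=> H; rewrite (_ : (fun y => _) = \sum_(i < n) F i); last first.
  by apply/funext => y; rewrite fct_sumE.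
by rewrite derive_sum// => i; exact: diff_derivable.
Qed.

Lemma derive_mul (V : normedModType R) (f g : V -> R) x v :
  differentiable f x -> differentiable g x ->
  'D_v (fun y => f y * g y) x = 'D_v f x * g x + f x * 'D_v g x.
Proof.
move=> df dg; rewrite (@deriveM _ _ f g); [|exact: diff_derivable|exact: diff_derivable].
by rewrite addrC; congr (_ + _); rewrite mulrC.
Qed.

Lemma grad_comp m n (T : 'rV[R]_m -> 'rV[R]_n) (f : 'rV[R]_n -> R) y :
  differentiable T y -> differentiable f (T y) ->
  grad (f \o T) y = grad f (T y) *m ('J T y)^T.
Proof.
move=> dT df; apply/rowP => k; rewrite mxE derive_comp// derive_gradE//.
rewrite deriveEjacobian// -mulmxA -rowE mxE.
by rewrite -[grad f (T y) in RHS]trmxK -trmx_mul [RHS]mxE.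
Qed.

Lemma differentiable_bigsum (V : normedModType R) n (F : 'I_n -> V -> R) x :
  (forall i, differentiable (F i) x) ->
  differentiable (fun y => \sum_(i < n) F i y) x.
Proof.
move=> H; rewrite (_ : (fun y => _) = \sum_(i < n) F i); first exact: differentiable_sum.
by apply/funext => y; rewrite fct_sumE.
Qed.

(** The canonical symplectic form, for coordinates in the order (positions, momenta). *)
Definition symplectic_mx {N : nat} : 'M[R]_(N + N) := block_mx 0 1%:M (- 1%:M) 0.

Lemma tr_symplectic_mx N : (@symplectic_mx N)^T = - symplectic_mx.
Proof. by rewrite /symplectic_mx tr_block_mx !trmx0 linearN/= !trmx1 opp_block_mx !oppr0 opprK. Qed.

(** In matrix form, the Jacobi identity and the invariance under symplectic maps become
    manipulations of matrix products. *)
Definition coord_bracket {N : nat} (f g : 'rV[R]_(N + N) -> R) (y : 'rV[R]_(N + N)) : R :=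
  (grad f y *m symplectic_mx *m (grad g y)^T) 0 0.

Lemma coord_bracketE N (f g : 'rV[R]_(N + N) -> R) y : coord_bracket f g y =
  \sum_(k < N) ('D_(delta_mx 0 (lshift N k)) f y * 'D_(delta_mx 0 (rshift N k)) g y
              - 'D_(delta_mx 0 (rshift N k)) f y * 'D_(delta_mx 0 (lshift N k)) g y).
Proof.
rewrite /coord_bracket -[grad f y]hsubmxK -[grad g y]hsubmxK tr_row_mx.
rewrite /symplectic_mx mul_row_block !mulmx0 mulmx1 mulmxN mulmx1 add0r addr0 mul_row_col.
rewrite mulNmx addrC mxE [X in _ + X]mxE !mxE -sumrN -big_split/=.
by apply: eq_bigr => k _; rewrite !mxE.
Qed.

Lemma smooth_coord_bracket N (W : set 'rV[R]_(N + N)) f g : open W ->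
  smooth W f -> smooth W g -> smooth W (coord_bracket f g).
Proof.
move=> oW sf sg; rewrite (funext (coord_bracketE f g)); apply: smooth_sum => // k _; apply: smoothB => //.
  by apply: smoothM => //; exact: smooth_derive.
by apply: smoothM => //; exact: smooth_derive.
Qed.

(** The second derivatives enter the gradient of a bracket only through this symmetric
    matrix. *)
Definition hess n (f : 'rV[R]_n -> R) y : 'M[R]_n :=
  \matrix_(a, b) 'D_(delta_mx 0 a) ('D_(delta_mx 0 b) f) y.

Lemma hess_sym n (W : set 'rV[R]_n) f y : open W -> W y -> smooth W f ->
  (hess f y)^T = hess f y.
Proof. by move=> oW Wy sf; apply/matrixP => a b; rewrite !mxE (derive_sym _ _ oW Wy sf). Qed.

Lemma grad_coord_bracket N (W : set 'rV[R]_(N + N)) f g y : open W -> W y ->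
  smooth W f -> smooth W g ->
  grad (coord_bracket f g) y = grad f y *m symplectic_mx *m hess g y - grad g y *m symplectic_mx *m hess f y.
Proof.
move=> oW Wy sf sg.
have dd h v : smooth W h -> differentiable ('D_v h) y.
  by move=> sh; apply: (smooth_diff (smooth_derive v sh)).
rewrite -(hess_sym oW Wy sf) -(hess_sym oW Wy sg); apply/rowP => c.
have -> : coord_bracket f g = fun x => \sum_(b < N + N) \sum_(a < N + N)
    (symplectic_mx a b * 'D_(delta_mx 0 a) f x) * 'D_(delta_mx 0 b) g x.
  apply/funext => x; rewrite /coord_bracket mxE; apply: eq_bigr => b _.
  rewrite !mxE mulr_suml; apply: eq_bigr => a _; rewrite mxE; ring.
have da a b : differentiable (fun x => symplectic_mx a b * 'D_(delta_mx 0 a) f x) y.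
  by apply: differentiableM; [exact: differentiable_cst|exact: dd].
have dab a b : differentiable (fun x => symplectic_mx a b * 'D_(delta_mx 0 a) f x * 'D_(delta_mx 0 b) g x) y.
  by apply: differentiableM => //; exact: dd.
rewrite mxE derive_bigsum; last first.
  by move=> b; exact: differentiable_bigsum.
under eq_bigr => b _.
  rewrite derive_bigsum//.
  under eq_bigr => a _.
    rewrite derive_mul; [|exact: da|exact: dd].
    rewrite derive_mul; [|exact: differentiable_cst|exact: dd].
    rewrite derive_cst mul0r add0r; over.
  rewrite big_split/=; over.
rewrite big_split/= addrC.
rewrite -[- _]mulNmx -[- _]mulmxN -tr_symplectic_mx mxE; congr (_ + _).
  rewrite mxE; apply: eq_bigr => b _; rewrite !mxE mulr_suml.
  by apply: eq_bigr => a _; rewrite [grad f y 0 a]mxE; ring.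
rewrite mxE exchange_big/=; apply: eq_bigr => a _; rewrite !mxE mulr_suml.
by apply: eq_bigr => b _; rewrite [grad g y 0 b]mxE [symplectic_mx^T b a]mxE; ring.
Qed.

(** Each Hessian occurs twice in the cyclic sum, in two terms with opposite signs that
    are transposes of each other because the Hessian is symmetric. *)
Lemma coord_bracket_jacobi N (W : set 'rV[R]_(N + N)) f g h y : open W -> W y ->
  smooth W f -> smooth W g -> smooth W h ->
  coord_bracket (coord_bracket f g) h y + coord_bracket (coord_bracket h f) g y
    + coord_bracket (coord_bracket g h) f y = 0.
Proof.
move=> oW Wy sf sg sh.
have [q [q_sym E]] : exists q : 'rV[R]_(N + N) -> 'M[R]_(N + N) -> 'rV[R]_(N + N) -> R,
    (forall X Y A, A^T = A -> q X A Y = q Y A X) /\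
    (forall a b c, smooth W a -> smooth W b -> coord_bracket (coord_bracket a b) c y =
      q (grad a y) (hess b y) (grad c y) - q (grad b y) (hess a y) (grad c y)).
  exists (fun X A Y => (X *m symplectic_mx *m A *m symplectic_mx *m Y^T) 0 0); split=> [X Y A AT|a b c sa sb].
    rewrite -[in RHS](trmxK (Y *m symplectic_mx *m A *m symplectic_mx *m X^T)) [RHS]mxE.
    rewrite !trmx_mul trmxK AT tr_symplectic_mx !(mulNmx, mulmxN) opprK.
    by rewrite !mulmxA.
  rewrite {1}/coord_bracket (grad_coord_bracket oW Wy sa sb) !mulmxBl.
  by rewrite [LHS]mxE; congr (_ + _); rewrite [LHS]mxE.
rewrite (E _ _ _ sf sg) (E _ _ _ sh sf) (E _ _ _ sg sh).
move: (hess_sym oW Wy sf) (hess_sym oW Wy sg) (hess_sym oW Wy sh).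
move: (grad f y) (grad g y) (grad h y) (hess f y) (hess g y) (hess h y).
move=> F G H A B C sA sB sC.
rewrite (q_sym F H B sB) (q_sym G H A sA) (q_sym F G C sC).
move: (q H B F) (q H A G) (q G C F) => a b c; ring.
Qed.

Lemma coord_bracket_symplectic N (T : 'rV[R]_(N + N) -> 'rV[R]_(N + N)) f g y :
  differentiable T y -> differentiable f (T y) -> differentiable g (T y) ->
  ('J T y)^T *m symplectic_mx *m 'J T y = symplectic_mx ->
  coord_bracket (f \o T) (g \o T) y = coord_bracket f g (T y).
Proof.
move=> dT df dg H; rewrite /coord_bracket (grad_comp dT df) (grad_comp dT dg) trmx_mul trmxK.
by rewrite -[in RHS]H !mulmxA.
Qed.

Lemma jacobianE m n (T : 'rV[R]_m -> 'rV[R]_n) y a b : differentiable T y ->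
  'J T y a b = 'D_(delta_mx 0 a) (fun x => T x 0 b) y.
Proof. by move=> dT; rewrite -derive_coord// deriveEjacobian// -rowE [RHS]mxE. Qed.

(** J is the Jacobian of the base map, M its effect on momenta, and B the dependence of
    the new momenta on the base point. The hypotheses say that M is the inverse
    transpose of J and that B J^T is symmetric. *)
Lemma symplectic_block N (J B M : 'M[R]_N) :
  M *m J^T = 1%:M -> (B *m J^T)^T = B *m J^T ->
  (block_mx J B 0 M)^T *m symplectic_mx *m block_mx J B 0 M = symplectic_mx.
Proof.
move=> MJ BJ; have JM : J^T *m M = 1%:M by apply: mulmx1C.
have JM' : M^T *m J = 1%:M by rewrite -[J]trmxK -trmx_mul JM trmx1.
have BE : B = B *m J^T *m M by rewrite -mulmxA JM mulmx1.
have BM : B^T *m M = M^T *m B.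
  by rewrite {1}BE trmx_mul BJ -!mulmxA JM mulmx1.
rewrite tr_block_mx trmx0 /symplectic_mx !mulmx_block.
rewrite !(mulmx0, mul0mx, mulmx1, mulmxN, add0r, addr0, mulNmx, mul1mx).
by rewrite JM JM' BM addNr.
Qed.

(** T is the lift of tau to the cotangent bundle, given implicitly by p = p' J^T. In
    this form no inverse matrix is differentiated: deriving the relation along the base
    gives B J^T = - (sum of p'_b times the Hessian of tau_b), which is symmetric. *)
Lemma cotangent_lift N (W : set 'rV[R]_(N + N)) (X : set 'rV[R]_N)
   (T : 'rV[R]_(N + N) -> 'rV[R]_(N + N)) (tau : 'rV[R]_N -> 'rV[R]_N) y :
  open W -> W y -> open X -> (forall y, W y -> X (lsubmx y)) ->
  (forall k, smooth W (fun y => T y 0 k)) ->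
  (forall k, smooth X (fun x => tau x 0 k)) ->
  (forall y, W y -> lsubmx (T y) = tau (lsubmx y)) ->
  (forall y, W y -> rsubmx y = rsubmx (T y) *m ('J tau (lsubmx y))^T) ->
  ('J T y)^T *m symplectic_mx *m 'J T y = symplectic_mx.
Proof.
move=> oW Wy oX WX sT st Tl Tr.
have dT : differentiable T y by apply: differentiable_rV => k; apply: smooth_diff (sT k) Wy.
have dt z : W z -> differentiable tau (lsubmx z).
  by move=> Wz; apply: differentiable_rV => k; apply: smooth_diff (st k) (WX _ Wz).
have nW : \forall z \near y, W z by exact: open_nbhs_nbhs (conj oW Wy).
have dl : differentiable (fun z : 'rV[R]_(N + N) => lsubmx z) y by exact: differentiable_lsubmx.
set J := 'J tau (lsubmx y).
have Dl (v : 'rV[R]_(N + N)) : 'D_v (fun z : 'rV[R]_(N + N) => lsubmx z) y = lsubmx v.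
  apply/rowP => k; rewrite derive_coord// mxE -[RHS](derive_proj y).
  by congr ('D_v _ y); apply/funext => z; rewrite mxE.
have L (v : 'rV[R]_(N + N)) b : 'D_v (fun z => T z 0 (lshift N b)) y = (lsubmx v *m J) 0 b.
  have -> : 'D_v (fun z => T z 0 (lshift N b)) y = 'D_v (fun z => tau (lsubmx z) 0 b) y.
    apply: near_eq_derive; apply: filterS nW => z Wz.
    by rewrite -Tl// mxE.
  rewrite -[LHS](@derive_coord _ _ _ (tau \o lsubmx)); last exact: differentiable_comp dl (dt _ Wy).
  by rewrite (derive_comp _ dl (dt _ Wy)) Dl deriveEjacobian//; exact: dt.
pose p := rsubmx (T y).
pose S (v : 'rV[R]_N) : 'M[R]_N := \matrix_(a, b) 'D_v ('D_(delta_mx 0 a) (fun x => tau x 0 b)) (lsubmx y).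
(* Differentiate the a-th component of p = p' J^T in the direction v. *)
have Rr (v : 'rV[R]_(N + N)) a : v 0 (rshift N a) =
   \sum_b ('D_v (fun z => T z 0 (rshift N b)) y * J a b + p 0 b * S (lsubmx v) a b).
  pose F b (z : 'rV[R]_(N + N)) := T z 0 (rshift N b) *
      ('D_(delta_mx 0 a) (fun x => tau x 0 b) (lsubmx z)).
  have -> : v 0 (rshift N a) = 'D_v (fun z : 'rV[R]_(N + N) => z 0 (rshift N a)) y.
    by rewrite derive_proj.
  have -> : 'D_v (fun z : 'rV[R]_(N + N) => z 0 (rshift N a)) y =
      'D_v (fun z => \sum_b F b z) y.
    apply: near_eq_derive; apply: filterS nW => z Wz.
    have := Tr z Wz => /(congr1 (fun w : 'rV[R]_N => w 0 a)); rewrite !mxE => ->.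
    apply: eq_bigr => b _; rewrite /F !mxE; congr (_ * _).
    by rewrite -deriveE ?derive_coord//; exact: dt.
  have d1 b : differentiable (fun z => T z 0 (rshift N b)) y by exact: smooth_diff (sT _) Wy.
  have d2 b : differentiable ('D_(delta_mx 0 a) (fun x => tau x 0 b)) (lsubmx y).
    exact: (smooth_diff (smooth_derive _ (st b)) (WX _ Wy)).
  have d3 b : differentiable ('D_(delta_mx 0 a) (fun x => tau x 0 b) \o lsubmx) y.
    exact: differentiable_comp dl (d2 b).
  rewrite derive_bigsum; last by move=> b; exact: differentiableM (d1 b) (d3 b).
  apply: eq_bigr => b _; rewrite (derive_mul _ (d1 b) (d3 b)); congr (_ * _ + _ * _).
  - by rewrite /J jacobianE//; exact: dt.
  - by rewrite mxE.
  - by rewrite [LHS](derive_comp _ dl (d2 b)) Dl mxE.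
have Jl k : lsubmx (delta_mx 0 (lshift N k) : 'rV[R]_(N + N)) = delta_mx 0 k.
  by apply/rowP => j; rewrite !mxE/= eq_lshift.
have Jr k : lsubmx (delta_mx 0 (rshift N k) : 'rV[R]_(N + N)) = 0.
  by apply/rowP => j; rewrite !mxE/= eq_lrshift.
have KE a b : 'J T y a b = 'D_(delta_mx 0 a) (fun x => T x 0 b) y by exact: jacobianE.
have SE (v : 'rV[R]_N) a b :
  S v a b = 'D_v ('D_(delta_mx 0 a) (fun x => tau x 0 b)) (lsubmx y) by rewrite mxE.
clearbody J S; move: ('J T y) KE => K KE.
have -> : K = block_mx J (ursubmx K) 0 (drsubmx K).
  rewrite -[LHS]submxK; congr block_mx.
    by apply/matrixP => a b; rewrite !mxE KE L Jl -rowE mxE.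
  by apply/matrixP => a b; rewrite 2!mxE KE L Jr mul0mx !mxE.
apply: symplectic_block.
  apply/matrixP => k a; have := Rr (delta_mx 0 (rshift N k)) a.
  rewrite Jr !mxE/= eq_rshift eq_sym => ->; apply: eq_bigr => b _.
  by rewrite SE derive0 mulr0 addr0 !mxE KE.
have BJ k a : (ursubmx K *m J^T) k a = - \sum_b p 0 b * S (delta_mx 0 k) a b.
  have := Rr (delta_mx 0 (lshift N k)) a.
  rewrite mxE eq_rlshift/= big_split/= Jl => /eqP.
  rewrite eq_sym addr_eq0 => /eqP <-; rewrite mxE; apply: eq_bigr => b _.
  by rewrite !mxE KE.
apply/matrixP => k a; rewrite mxE !BJ; congr (- _); apply: eq_bigr => b _.
suff -> : S (delta_mx 0 k) a b = S (delta_mx 0 a) k b by [].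
rewrite (SE (delta_mx 0 k) a b) (SE (delta_mx 0 a) k b).
exact: (@derive_sym _ _ X (fun x => tau x 0 b) (lsubmx y) (delta_mx 0 a) (delta_mx 0 k) oX (WX _ Wy) (st b)).
Qed.

End Bracket.

(** * Charted spaces and extension by zero *)

Section Charts.
Context {R : realType} {N : nat} (M : charted_space R N).
Implicit Types (i j : idx M) (x z : M) (A : set M) (f g : M -> R).

(** The last field separates a point of a chart from a point outside it. This is the
    separation used to extend functions by zero, and a vector bundle inherits it from
    its base because its charts are unions of fibres. *)
Record smooth_atlas : Prop := SmoothAtlas {
  at_chart_at : forall x, dom M (chart_at M x) x;
  at_chartK : forall i x, dom M i x -> unchart M i (chart M i x) = x;
  at_open : forall i j, open (chart M i @` (dom M i `&` dom M j));
  at_transition : forall i j k,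
    smooth (chart M i @` (dom M i `&` dom M j))
           (fun y => chart M j (unchart M i y) 0 k);
  at_separated : forall i x z, dom M i x -> ~ dom M i z ->
    exists A B : set M, [/\ mopen A, mopen B, A x, B z & A `&` B = set0] }.

Hypothesis atM : smooth_atlas.

Local Notation cdom i := (chart M i @` dom M i).

Lemma unchartP i A y : (chart M i @` (dom M i `&` A)) y ->
  [/\ dom M i (unchart M i y), A (unchart M i y) & chart M i (unchart M i y) = y].
Proof. by move=> [x [dx Ax] <-]; rewrite (at_chartK atM dx). Qed.

Lemma open_cdom i : open (cdom i).
Proof. by rewrite -(setIid (dom M i)); exact: at_open. Qed.

Lemma cdomP i y : cdom i y -> dom M i (unchart M i y) /\ chart M i (unchart M i y) = y.
Proof. by move=> [x dx <-]; rewrite (at_chartK atM dx). Qed.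

Lemma near_cdom i x : dom M i x -> \forall y \near chart M i x, cdom i y.
Proof. by move=> dx; apply: open_nbhs_nbhs; split; [exact: open_cdom|exists x]. Qed.

Lemma near_overlap i j x : dom M i x -> dom M j x ->
  \forall y \near chart M i x, (chart M i @` (dom M i `&` dom M j)) y.
Proof. by move=> dx dx'; apply: open_nbhs_nbhs; split; [exact: at_open|exists x]. Qed.

Lemma near_mopen i x A : mopen A -> dom M i x -> A x ->
  \forall y \near chart M i x, (chart M i @` (dom M i `&` A)) y.
Proof. by move=> oA dx Ax; apply: open_nbhs_nbhs; split; [exact: oA|exists x]. Qed.

Lemma differentiable_transition i j x : dom M i x -> dom M j x ->
  differentiable (chart M j \o unchart M i) (chart M i x).
Proof.
move=> dx dx'; apply: differentiable_rV => k.
by apply: (smooth_diff (at_transition atM i j k)); exists x.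
Qed.

Lemma near_transition (T : Type) (f : M -> T) i j x : dom M i x -> dom M j x ->
  \forall y \near chart M i x,
    (f \o unchart M i) y = ((f \o unchart M j) \o (chart M j \o unchart M i)) y.
Proof.
move=> dx dx'; apply: filterS (near_overlap dx dx') => y /unchartP[d d' E].
by rewrite /= (at_chartK atM d').
Qed.

Lemma smooth_fun_diff f i x : smooth_fun f -> dom M i x ->
  differentiable (f \o unchart M i) (chart M i x).
Proof. by move=> sf dx; apply: (smooth_diff (sf i)); exists x. Qed.

Lemma smooth_fun_cst (c : R) : smooth_fun (fun _ : M => c).
Proof. by move=> i; apply: smooth_cst; exact: open_cdom. Qed.

Lemma smooth_funD f g : smooth_fun f -> smooth_fun g ->
  smooth_fun (fun x => f x + g x).
Proof. by move=> sf sg i; apply: smoothD; [exact: open_cdom|exact: sf|exact: sg]. Qed.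

Lemma smooth_funB f g : smooth_fun f -> smooth_fun g ->
  smooth_fun (fun x => f x - g x).
Proof. by move=> sf sg i; apply: smoothB; [exact: open_cdom|exact: sf|exact: sg]. Qed.

Lemma smooth_funM f g : smooth_fun f -> smooth_fun g ->
  smooth_fun (fun x => f x * g x).
Proof. by move=> sf sg i; apply: smoothM; [exact: open_cdom|exact: sf|exact: sg]. Qed.

Lemma smooth_fun_sum (I : Type) (s : seq I) (P : pred I) (F : I -> M -> R) :
  (forall k, P k -> smooth_fun (F k)) ->
  smooth_fun (fun x => \sum_(k <- s | P k) F k x).
Proof.
move=> H i; apply: (@smooth_sum _ _ _ I s P (fun k => F k \o unchart M i)).
  exact: open_cdom.
by move=> k Pk; exact: H.
Qed.

Lemma smooth_fun_prod (I : Type) (s : seq I) (P : pred I) (F : I -> M -> R) :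
  (forall k, P k -> smooth_fun (F k)) ->
  smooth_fun (fun x => \prod_(k <- s | P k) F k x).
Proof.
move=> H i; apply: (@smooth_prod _ _ _ I s P (fun k => F k \o unchart M i)).
  exact: open_cdom.
by move=> k Pk; exact: H.
Qed.

(** A function on an open set A becomes global after multiplication by a cutoff rho.
    The product extended by zero is smooth at a point outside the chart at z because
    such a point has a neighbourhood that misses the support of rho: this support is
    compact, and its points are separated from the given one. *)
Lemma smooth_extension A f z : mopen A -> A z ->
  (forall i, smooth (chart M i @` (dom M i `&` A)) (f \o unchart M i)) ->
  exists (rho F : M -> R),
    [/\ smooth_fun F, rho z != 0,
        forall x, A x -> F x = rho x * f x,
        forall x, ~ A x -> F x = 0 &
        differentiable (rho \o unchart M (chart_at M z)) (chart M (chart_at M z) z)].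
Proof.
move=> oA Az sf; set i := chart_at M z.
have dz : dom M i z by exact: at_chart_at.
have /nbhs_ballP[d /= d0 dA] := near_mopen oA dz Az.
(* The closed box of radius e is compact and lies inside the open ball of
   radius d, hence inside the image of A. *)
pose e := d / 2; have e0 : 0 < e by rewrite divr_gt0.
have ed : e < d by rewrite /e; move: d0; lra.
pose c := chart M i z.
pose K := [set y : 'rV[R]_N | forall k, `|y 0 k - c 0 k| <= e].
have KA y : K y -> (chart M i @` (dom M i `&` A)) y.
  by move=> Ky; apply: dA; apply: box_ball Ky => //; exact: ltW.
have bK y : bump c e y != 0 -> K y.
  by move=> by0 k; apply/ltW/(bump_supp e0 by0).
pose rho x := if `[< dom M i x /\ A x >] then bump c e (chart M i x) else 0.
pose F x := if `[< A x >] then rho x * f x else 0.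
have rhoE x : dom M i x -> A x -> rho x = bump c e (chart M i x).
  by move=> dx Ax; rewrite /rho; case: asboolP => // -[].
have FA x : A x -> F x = rho x * f x by rewrite /F; case: asboolP.
have FNA x : ~ A x -> F x = 0 by rewrite /F; case: asboolP.
have F0 x : (dom M i x -> ~ K (chart M i x)) -> F x = 0.
  move=> H; rewrite /F; case: asboolP => // Ax; rewrite /rho.
  case: asboolP => [[dx _]|]; last by rewrite mul0r.
  have [->|/bK Kx] := eqVneq (bump c e (chart M i x)) 0; first by rewrite mul0r.
  by case: (H dx).
have F0near j x : (\forall y \near chart M j x, F (unchart M j y) = 0) ->
    smooth [set chart M j x] (F \o unchart M j).
  move=> H; apply: (@smooth_near _ _ _ (fun=> 0)).
    by apply: filterS H => y /= ->.
  exact: (smooth_sub (@subsetT _ _) (smooth_cst 0 openT)).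
have cK : compact K by exact: compact_box.
exists rho, F; split=> //.
- move=> j; apply/smoothP => _ [x dx <-].
  have [dix|ndix] := pselect (dom M i x); last first.
    (* x is separated from the compact image of K *)
    apply: F0near.
    have : \forall y \near chart M j x, K `<=` (fun y' => unchart M j y <> unchart M i y').
      move/compact_near_coveringP : cK => cK.
      apply: (cK _ (nbhs (chart M j x)) (fun y y' => unchart M j y <> unchart M i y')).
      move=> y' /KA /unchartP[d1 A1 E1].
      have [B1 [B2 [oB1 oB2 B1y B2x B12]]] := at_separated atM d1 ndix.
      exists (chart M i @` (dom M i `&` B1), chart M j @` (dom M j `&` B2)) => /=.
        split; last exact: near_mopen.
        by have := near_mopen oB1 d1 B1y; rewrite E1.
      move=> [y1 y2] /= [/unchartP[_ Bu1 _] /unchartP[_ Bu2 _]] E.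
      have : (B1 `&` B2) (unchart M i y1) by split=> //; rewrite -E.
      by rewrite B12.
    apply: filterS => y H; apply: F0 => dy Ky.
    by apply: (H _ Ky); rewrite (at_chartK atM dy).
  have [Ax|nAx] := pselect (A x).
    pose W := chart M j @` (dom M j `&` A) `&` chart M j @` (dom M j `&` dom M i).
    have oW : open W by apply: openI; [exact: oA|exact: at_open].
    have Wx : W (chart M j x) by split; exists x.
    suff sW : smooth W (F \o unchart M j) by apply: (smooth_sub _ sW) => _ ->.
    have sb : smooth W (bump c e \o (chart M i \o unchart M j)).
      apply: (@smooth_comp _ _ _ _ setT) => //; first exact: smooth_bump.
      by move=> k; apply: smooth_sub (at_transition atM j i k) => y [].
    have sfj : smooth W (f \o unchart M j) by apply: smooth_sub (sf j) => y [].
    apply: (smooth_eq oW _ (smoothM oW sb sfj)) => y.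
    rewrite inE => -[/unchartP[_ Ay _] /unchartP[_ dy _]] /=.
    by rewrite FA// rhoE.
  apply: F0near.
  have nK : ~ K (chart M i x).
    by move=> /KA /unchartP[_ + _]; rewrite (at_chartK atM dix).
  have := differentiable_continuous (differentiable_transition dx dix).
  have oK : open (~` K) by apply: closed_openC; apply: compact_closed cK; exact: norm_hausdorff.
  have nbK : nbhs ((chart M i \o unchart M j) (chart M j x)) (~` K).
    by apply: open_nbhs_nbhs; split=> //=; rewrite (at_chartK atM dx).
  move=> ct.
  have nKy : \forall y \near chart M j x, ~ K (chart M i (unchart M j y)) := ct _ nbK.
  by apply: filterS nKy => y Hy; exact: F0.
- by rewrite rhoE// bump_center.
- apply: (@differentiable_near _ _ _ (bump c e)).
    apply: filterS (near_mopen oA dz Az) => y /unchartP[d1 A1 E1].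
    by rewrite /= rhoE// E1.
  exact: smooth_diff (smooth_bump c e) _.
Qed.

End Charts.

(** * Tangency to a submanifold *)

Lemma smooth_id (R : realType) (W : set R) : open W -> smooth W (fun s : R => s).
Proof.
move=> oW [|d]; first by split=> // x _; exact: ex_diff.
split=> [x _|v]; first exact: ex_diff.
apply: (diff_upto_eq oW _ (@diff_upto_cst _ _ d W v oW)) => x _.
by rewrite derive_id.
Qed.

Section Tangent.
Context {R : realType} {N : nat} (M : charted_space R N).
Implicit Types (S : set M) (X : (M -> R) -> M -> R) (z : M).

Lemma tangent_kills S X z phi : tangent_at S X z -> smooth_fun phi ->
  vanishes_on S phi -> X phi z = 0.
Proof.
move=> [c [e [e0 c0 cS _ H]]] sphi phi0.
rewrite -(@derive_val _ _ _ _ _ _ _ (H phi sphi)).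
rewrite (@near_eq_derive _ _ _ _ (cst 0)) ?derive_cst//.
exists e => //= s; rewrite /= sub0r normrN => se /=.
by apply: phi0; have [] := cS s se.
Qed.

Hypothesis atM : smooth_atlas M.

(** The curve is a straight line in a slice chart, carried back to M. Its velocity w in
    the slice chart has no components across S: such a component is the derivative of
    a slice coordinate, and a cutoff of this coordinate is a global function that
    vanishes on S. *)
Lemma tangent_of_kills S X z (v : 'rV[R]_N) : is_submanifold S -> S z ->
  (forall f, smooth_fun f ->
     X f z = 'D_v (f \o unchart M (chart_at M z)) (chart M (chart_at M z) z)) ->
  (forall phi, smooth_fun phi -> vanishes_on S phi -> X phi z = 0) ->
  tangent_at S X z.
Proof.
move=> [d [_ /(_ z)]] + Sz => /(_ Sz) [U [psi [psi' [[oU Uz] psiK spsi [spsi' opsi] SE]]]] XE X0.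
set j := chart_at M z in XE *; set y0 := chart M j z.
have dz : dom M j z by exact: at_chart_at.
have spsij i k : smooth (chart M i @` (dom M i `&` U)) (fun x => (psi (unchart M i x) : 'rV[R]_N) 0 k).
  by have [_] := spsi i tt; rewrite /= preimage_setT setIT => /(_ k).
pose P := psi \o unchart M j : _ -> 'rV[R]_N.
have dP : differentiable P y0.
  by apply: differentiable_rV => k; apply: (smooth_diff (spsij j k)); exists z.
pose w : 'rV[R]_N := 'D_v P y0.
(* The slice coordinates psi_k with d <= k vanish on S; rho * psi_k is a
   global function vanishing on S, so X kills it, and rho z != 0. *)
have wk (k : 'I_N) : (d <= k)%N -> w 0 k = 0.
  move=> dk; rewrite /w derive_coord//.
  have [rho [F [sF rz FU FN drho]]] := @smooth_extension _ _ _ atM U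
    (fun x => (psi x : 'rV[R]_N) 0 k) z oU Uz (fun i => spsij i k).
  have pz : (psi z : 'rV[R]_N) 0 k = 0 by have [+ _] := SE _ Uz; move=> /(_ Sz); exact.
  have F0 : vanishes_on S F.
    move=> x Sx; have [Ux|] := pselect (U x); last exact: FN.
    by rewrite FU//; have [+ _] := SE _ Ux; move=> /(_ Sx k dk) ->; rewrite mulr0.
  have := X0 _ sF F0; rewrite XE// -/y0.
  have -> : 'D_v (F \o unchart M j) y0 = 'D_v (fun y => (rho \o unchart M j) y * P y 0 k) y0.
    apply: near_eq_derive; apply: filterS (near_mopen oU dz Uz) => y.
    by move=> /(unchartP atM)[_ Uy _] /=; rewrite FU.
  rewrite derive_mul//; last exact: differentiable_comp_coord.
  rewrite [X in _ * X + _](_ : _ = 0) ?mulr0 ?add0r; last first.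
    by rewrite /P /= (at_chartK atM dz).
  rewrite /= (at_chartK atM dz) => /eqP; rewrite mulf_eq0 (negbTE rz)/= => /eqP.
  by [].
pose H := chart M j \o psi' : 'rV[R]_N -> 'rV[R]_N.
pose W := (psi @` U : set 'rV[R]_N) `&` psi' @^-1` dom M j.
have [oW sH] : open W /\ forall k, smooth W (fun x => H x 0 k).
  by have := spsi' tt j; rewrite /= image_id setTI.
have Wz : W (psi z) by split; [exists z|rewrite /= psiK].
have dH : differentiable H (psi z).
  by apply: differentiable_rV => k; exact: smooth_diff (sH k) Wz.
pose u (s : R) : 'rV[R]_N := (psi z : 'rV[R]_N) + s *: w.
have u0 : u 0 = psi z by rewrite /u scale0r addr0.
have /nbhs_ballP[r /= r0 rW] := open_nbhs_nbhs (conj oW Wz).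
pose e := r / (`|w| + 1).
have w1 : 0 < `|w| + 1 by rewrite ltr_wpDl.
have e0 : 0 < e by rewrite divr_gt0.
have oB : open [set s : R | `|s| < e].
  have -> : [set s : R | `|s| < e] = ball (0 : R) e.
    by apply/seteqP; split=> s; rewrite -ball_normE /= sub0r normrN.
  exact: ball_open.
have uW s : `|s| < e -> W (u s).
  move=> se; apply: rW; rewrite -ball_normE /= /u opprD addNKr normrN normrZ.
  apply: (@le_lt_trans _ _ (`|s| * (`|w| + 1))); last by rewrite -ltr_pdivlMr.
  by rewrite ler_wpM2l// lerDl.
(* psi' undoes psi, so the curve s |-> psi' (psi z + s w) has velocity v. *)
have DH : 'D_w H (psi z) = v.
  have E : P y0 = psi z by rewrite /P/= (at_chartK atM dz).
  have dH' : differentiable H (P y0) by rewrite E.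
  rewrite /w -E -(derive_comp v dP dH').
  rewrite (@near_eq_derive _ _ _ _ id) ?derive_id//.
  apply: filterS (near_mopen oU dz Uz) => y /(unchartP atM)[dy Uy yE].
  by rewrite /H /P /= psiK.
have du : is_diff (0 : R) u (fun s => 0 + s *: w) by apply: is_diffD.
have du' : differentiable u 0 by exact: ex_diff.
exists (psi' \o u), e; split=> //.
- by rewrite /= u0 psiK.
- move=> s se; have [[x Ux xE] ds] := uW s se; split=> //=.
  rewrite -xE psiK//; apply/(SE _ Ux) => k dk; rewrite xE /u !mxE wk// mulr0 addr0.
  by have [+ _] := SE _ Uz; move=> /(_ Sz); exact.
- move=> k; apply: (@smooth_comp _ _ _ _ W (fun x => H x 0 k) u) => // i.
  have sL : smooth [set s : R | `|s| < e] (fun s : R => (psi z : 'rV[R]_N) 0 i + s * w 0 i).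
    apply: smoothD => //; first exact: smooth_cst.
    by apply: smoothM => //; [exact: smooth_id|exact: smooth_cst].
  by apply: (smooth_eq oB _ sL) => s _; rewrite /u !mxE.
- move=> f sf; have df := smooth_fun_diff sf dz.
  have dHu : differentiable (H \o u) 0 by apply: differentiable_comp => //; rewrite u0.
  have HuE : (H \o u) 0 = y0 by rewrite /= u0 /H/= psiK.
  have E : \forall s \near (0 : R), ((f \o unchart M j) \o (H \o u)) s = (f \o (psi' \o u)) s.
    exists e => //= s; rewrite /= sub0r normrN => se.
    by have [_ ds] := uW s se; rewrite /H/= (at_chartK atM ds).
  apply: near_eq_is_derive E _; rewrite XE//; apply: DeriveDef.
    by apply/diff_derivable/differentiable_comp; rewrite ?HuE.
  rewrite derive_comp ?HuE//; congr ('D_ _ _ _).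
  have dHu0 : differentiable H (u 0) by rewrite u0.
  by rewrite (derive_comp (1 : R) du' dHu0) (deriveE _ du') diff_val add0r scale1r u0.
Qed.

End Tangent.

(** * Vector bundles over the total space *)

Section Jacobian.
Context {R : realType}.

Lemma eq_mul_delta m n (A B : 'M[R]_(m, n)) :
  (forall k, delta_mx 0 k *m A = (delta_mx 0 k *m B : 'rV[R]_n)) -> A = B.
Proof. by move=> H; apply/row_matrixP => k; rewrite (rowE k A) (rowE k B). Qed.

Lemma jacobian_comp m n p (T : 'rV[R]_m -> 'rV[R]_n) (S : 'rV[R]_n -> 'rV[R]_p) y :
  differentiable T y -> differentiable S (T y) ->
  'J (S \o T) y = 'J T y *m 'J S (T y).
Proof.
move=> dT dS; apply: eq_mul_delta => k; rewrite mulmxA.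
rewrite -(deriveEjacobian _ dT) -(deriveEjacobian _ dS) -derive_comp//.
by rewrite deriveEjacobian//; exact: differentiable_comp.
Qed.

Lemma jacobian_near m n (T S : 'rV[R]_m -> 'rV[R]_n) y :
  (\forall x \near y, T x = S x) -> differentiable T y -> 'J T y = 'J S y.
Proof.
move=> TS dT; have dS := differentiable_near TS dT.
apply: eq_mul_delta => k.
exact: etrans (esym (deriveEjacobian _ dT))
  (etrans (near_eq_derive _ TS) (deriveEjacobian _ dS)).
Qed.

Lemma jacobian_id m (y : 'rV[R]_m) : 'J id y = 1%:M.
Proof.
have did : differentiable (id : 'rV[R]_m -> 'rV[R]_m) y by exact: ex_diff.
by apply: eq_mul_delta => k; rewrite -(deriveEjacobian _ did) derive_id mulmx1.
Qed.

Lemma open_lsubmx m n (A : set 'rV[R]_m) : open A ->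
  open [set y : 'rV[R]_(m + n) | A (lsubmx y)].
Proof.
move=> oA; apply: (@open_comp _ _ (fun y : 'rV[R]_(m + n) => lsubmx y)) => // y _.
exact/differentiable_continuous/differentiable_lsubmx.
Qed.

Lemma smooth_lsubmx (V : normedModType R) m n (W : set V) (T : V -> 'rV[R]_(m + n)) :
  open W -> (forall k, smooth W (fun x => T x 0 k)) ->
  forall k, smooth W (fun x => (lsubmx (T x)) 0 k).
Proof. by move=> oW H k; apply: (smooth_eq oW _ (H (lshift n k))) => x _; rewrite mxE. Qed.

End Jacobian.

Section VectorBundle.
Context {R : realType} {n : nat} (E : fibre_bundle R n).
Local Notation N := (1 + n)%N.

Lemma total_atlas : smooth_atlas E.
Proof.
have mE := fb_total E; split.
- exact: mf_chart_at.
- exact: mf_chartK.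
- exact: mf_open.
- exact: mf_transition.
- move=> i x z dx dz; apply: mf_hausdorff => //.
  by move=> xz; apply: dz; rewrite -xz.
Qed.

Let atE := total_atlas.

(** The common shape of the charted spaces T^*E and J^1pi^*: fibre components are kept in
    the preferred chart of the base point and transformed by a cocycle. *)
Definition vector_bundle (m : nat) (c : idx E -> idx E -> E -> 'M[R]_m) : charted_space R (N + m) :=
  @ChartedSpace R (N + m) (E * 'rV[R]_m)%type (idx E)
    (fun i z => dom E i z.1)
    (fun i z => row_mx (chart E i z.1)
       (z.2 *m (c i (chart_at E z.1) z.1)^T))
    (fun i x => let e := unchart E i (lsubmx x) in
       (e, rsubmx x *m (c (chart_at E e) i e)^T))
    (fun z => chart_at E z.1).

Record cocycle (m : nat) (c : idx E -> idx E -> E -> 'M[R]_m) : Prop := Cocycle {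
  cocycle_id : forall i e, dom E i e -> c i i e = 1%:M;
  cocycle_mul : forall i j k e, dom E i e -> dom E j e -> dom E k e ->
    c i j e *m c j k e = c i k e;
  cocycle_smooth : forall i j a b, smooth (chart E i @` (dom E i `&` dom E j))
    (fun x => c j i (unchart E i x) a b) }.

Section Cocycle.
Context {m : nat} {c : idx E -> idx E -> E -> 'M[R]_m} (cc : cocycle c).

Lemma vector_bundle_transition i j y : dom E i (unchart E i (lsubmx y)) ->
  dom E j (unchart E i (lsubmx y)) ->
  chart (vector_bundle c) j (unchart (vector_bundle c) i y) =
  row_mx (chart E j (unchart E i (lsubmx y)))
         (rsubmx y *m (c j i (unchart E i (lsubmx y)))^T).
Proof.
move=> di dj /=; congr row_mx; rewrite -mulmxA -trmx_mul (cocycle_mul cc)//.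
exact: at_chart_at.
Qed.

Lemma vector_bundle_chartK i (z : vector_bundle c) : dom (vector_bundle c) i z ->
  unchart (vector_bundle c) i (chart (vector_bundle c) i z) = z.
Proof.
case: z => e p /= de; rewrite row_mxKl row_mxKr (at_chartK atE de).
have dp := at_chart_at atE e.
by rewrite -mulmxA -trmx_mul (cocycle_mul cc)// (cocycle_id cc)// trmx1 mulmx1.
Qed.

Lemma vector_bundle_image i (A : set E) :
  chart (vector_bundle c) i @` (dom (vector_bundle c) i `&` fst @^-1` A) =
  [set y | (chart E i @` (dom E i `&` A)) (lsubmx y)].
Proof.
apply/seteqP; split=> y.
  by move=> [[e p] [/= de Ae] <-]; rewrite row_mxKl; exists e.
move=> /(unchartP atE)[d Ae Eq]; exists (unchart (vector_bundle c) i y) => //.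
by rewrite vector_bundle_transition// Eq (cocycle_id cc)// trmx1 mulmx1 hsubmxK.
Qed.

Lemma vector_bundle_mopen (A : set E) : mopen A -> mopen (fst @^-1` A : set (vector_bundle c)).
Proof. by move=> oA i; rewrite vector_bundle_image; exact/open_lsubmx/oA. Qed.

Lemma vector_bundle_overlap i j :
  chart (vector_bundle c) i @` (dom (vector_bundle c) i `&` dom (vector_bundle c) j) =
  [set y | (chart E i @` (dom E i `&` dom E j)) (lsubmx y)].
Proof. exact: vector_bundle_image. Qed.

Lemma vector_bundle_atlas : smooth_atlas (vector_bundle c).
Proof.
split.
- by move=> x; exact: (at_chart_at atE).
- exact: vector_bundle_chartK.
- by move=> i j; rewrite vector_bundle_overlap; exact/open_lsubmx/(at_open atE).
- move=> i j k; rewrite vector_bundle_overlap; set W := [set y | _].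
  have oW : open W by exact/open_lsubmx/(at_open atE).
  pose T (y : 'rV[R]_(N + m)) := row_mx (chart E j (unchart E i (lsubmx y)))
         (rsubmx y *m (c j i (unchart E i (lsubmx y)))^T).
  apply: (@smooth_eq _ _ _ (fun y => T y 0 k)) => //.
    move=> y; rewrite inE => /(unchartP atE)[d1 d2 _].
    by rewrite vector_bundle_transition.
  have sl k' : smooth W (fun y : 'rV[R]_(N + m) => lsubmx y 0 k').
    by apply: smooth_lsubmx => // k''; exact: smooth_coord.
  rewrite /T; case: (split_ordP k) => a ->.
    apply: (@smooth_eq _ _ _ ((fun x => chart E j (unchart E i x) 0 a) \o lsubmx)) => //.
      by move=> y _; rewrite row_mxEl.
    by apply: smooth_comp sl => //; [|exact: (at_transition atE)].
  have sS : smooth W (fun y : 'rV[R]_(N + m) => \sum_b y 0 (rshift N b) *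
      ((fun x => c j i (unchart E i x) a b) \o lsubmx) y).
    apply: smooth_sum => // b _; apply: smoothM => //; first exact: smooth_coord.
    by apply: smooth_comp sl => //; [|exact: cocycle_smooth].
  apply: (smooth_eq oW _ sS) => y _; rewrite row_mxEr mxE.
  by apply: eq_bigr => b _; rewrite !mxE.
- move=> i x z dx dz; have [A [B [oA oB Ax Bz AB]]] := at_separated atE dx dz.
  exists (fst @^-1` A), (fst @^-1` B); split=> //; [exact: vector_bundle_mopen|exact: vector_bundle_mopen|].
  by rewrite -preimage_setI AB preimage_set0.
Qed.

End Cocycle.

Lemma changeE i j e a b : dom E i e -> dom E j e ->
  change i j e a b = 'D_(delta_mx 0 a) (fun x => chart E j (unchart E i x) 0 b) (chart E i e).
Proof. by move=> di dj; rewrite /change jacobianE//; exact: (differentiable_transition atE). Qed.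

Lemma change_cocycle : cocycle (@change R n E).
Proof.
split.
- move=> i e de; rewrite /change (@jacobian_near _ _ _ _ id) ?jacobian_id//.
    by apply: filterS (near_cdom atE de) => y /(cdomP atE)[_].
  exact: (differentiable_transition atE).
- move=> i j k e di dj dk; rewrite /change.
  have E1 : chart E j e = (chart E j \o unchart E i) (chart E i e).
    by rewrite /= (at_chartK atE di).
  have d1 := differentiable_transition atE di dj.
  have d2 := differentiable_transition atE dj dk.
  have d2' : differentiable (chart E k \o unchart E j) ((chart E j \o unchart E i) (chart E i e)).
    by rewrite -E1.
  have J12 := jacobian_comp d1 d2'; rewrite -E1 in J12.
  apply: etrans (esym J12) _.
  apply: jacobian_near; last exact: differentiable_comp d1 d2'.
  apply: filterS (near_overlap atE di dj) => y /(unchartP atE)[_ d' _].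
  by rewrite /= (at_chartK atE d').
- move=> i j a b; set W := chart E i @` _; have oW : open W by exact: (at_open atE).
  pose g := 'D_(delta_mx 0 a) (fun x => chart E i (unchart E j x) 0 b).
  apply: (@smooth_eq _ _ _ (g \o (chart E j \o unchart E i))) => //.
    by move=> y; rewrite inE => /(unchartP atE)[d1 d2 _]; rewrite changeE.
  apply: (@smooth_comp _ _ _ _ (chart E j @` (dom E j `&` dom E i))) => //.
  + by move=> y /(unchartP atE)[d1 d2 _]; exists (unchart E i y).
  + exact/smooth_derive/(at_transition atE).
  + by move=> k; exact: (at_transition atE).
Qed.

(** All charts are fibred over the same time coordinate, so dt has components (1, 0) in
    each of them. *)
Lemma change_time i j e a : dom E i e -> dom E j e ->
  change i j e a (lshift n ord0) = (a == lshift n ord0)%:R.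
Proof.
move=> di dj; rewrite changeE//.
rewrite (@near_eq_derive _ _ _ _ (fun x : 'rV[R]_N => x 0 (lshift n ord0))).
  by rewrite derive_proj mxE eqxx eq_sym.
apply: filterS (near_overlap atE di dj) => y /(unchartP atE)[d1 d2 Eq].
by rewrite fb_fibred// -(fb_fibred d1) Eq.
Qed.

Lemma change_block i j e : dom E i e -> dom E j e ->
  change i j e = block_mx 1%:M (ursubmx (change i j e)) 0 (vchange i j e).
Proof.
move=> di dj; rewrite -[LHS]submxK; congr block_mx.
  apply/matrixP => a b; rewrite 2!mxE ord1 [b]ord1 change_time// mxE.
  by rewrite !eqxx.
apply/matrixP => a b; rewrite 2!mxE [b]ord1 change_time// mxE.
by rewrite eq_rlshift.
Qed.

Lemma vchange_cocycle : cocycle (@vchange R n E).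
Proof.
have cc := change_cocycle; split.
- by move=> i e de; rewrite /vchange (cocycle_id cc)// scalar_mx_block block_mxKdr.
- move=> i j k e di dj dk; rewrite {3}/vchange -(cocycle_mul cc di dj dk).
  rewrite (change_block di dj) (change_block dj dk) mulmx_block block_mxKdr.
  by rewrite mul0mx add0r.
- move=> i j a b; apply: (@smooth_eq _ _ _
    (fun x => change j i (unchart E i x) (rshift 1 a) (rshift 1 b))).
  + exact: (at_open atE).
  + by move=> x _; rewrite !mxE.
  + exact: (cocycle_smooth cc).
Qed.

Lemma TE_atlas : smooth_atlas (TE E).
Proof. exact: vector_bundle_atlas change_cocycle. Qed.

Lemma J1d_atlas : smooth_atlas (J1d E).
Proof. exact: vector_bundle_atlas vchange_cocycle. Qed.

End VectorBundle.

(** * Brackets defined by partial derivatives *)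

Lemma derive_sumr (R : realType) (V : normedModType R) (f : V -> R) x n (w : 'I_n -> V) :
  differentiable f x -> 'D_(\sum_k w k) f x = \sum_k 'D_(w k) f x.
Proof.
move=> df; elim/big_ind2 : _ => [|a b c d <- <-|//]; first exact: derive0.
exact: deriveDr.
Qed.

Section Poisson.
Context {R : realType} {N : nat} (M : charted_space R N) (atM : smooth_atlas M).
Context {s : nat} (p q : 'I_s -> 'I_N).
Implicit Types (f g h : M -> R) (x : M).

(** The brackets of T^*E and of J^1pi^* are both of this form; p and q select the
    indices of positions and of the conjugate momenta. *)
Definition poisson f g x : R :=
  \sum_(k < s) (partial (p k) f x * partial (q k) g x
              - partial (q k) f x * partial (p k) g x).

Let dM f x : smooth_fun f ->
  differentiable (f \o unchart M (chart_at M x)) (chart M (chart_at M x) x).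
Proof. by move=> sf; apply: smooth_fun_diff => //; exact: at_chart_at. Qed.

Lemma ddirD f g x v : smooth_fun f -> smooth_fun g ->
  ddir (fun y => f y + g y) x v = ddir f x v + ddir g x v.
Proof.
move=> sf sg; have df := dM x sf; have dg := dM x sg.
exact: (@deriveD _ _ _ (f \o unchart M (chart_at M x)) (g \o _) _ v
  (diff_derivable df) (diff_derivable dg)).
Qed.

Lemma ddirB f g x v : smooth_fun f -> smooth_fun g ->
  ddir (fun y => f y - g y) x v = ddir f x v - ddir g x v.
Proof.
move=> sf sg; have df := dM x sf; have dg := dM x sg.
exact: (@deriveB _ _ _ (f \o unchart M (chart_at M x)) (g \o _) _ v
  (diff_derivable df) (diff_derivable dg)).
Qed.

Lemma ddirM f g x v : smooth_fun f -> smooth_fun g ->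
  ddir (fun y => f y * g y) x v = ddir f x v * g x + f x * ddir g x v.
Proof.
move=> sf sg; have df := dM x sf; have dg := dM x sg.
rewrite /ddir [LHS](derive_mul v df dg) /=.
by rewrite (at_chartK atM (at_chart_at atM x)).
Qed.

Lemma ddir_cst (c : R) x v : ddir (fun _ : M => c) x v = 0.
Proof. exact: derive_cst. Qed.

Lemma poissonC f g x : poisson f g x = - poisson g f x.
Proof.
rewrite /poisson -sumrN; apply: eq_bigr => k _.
by rewrite opprB mulrC; congr (_ - _); rewrite mulrC.
Qed.

Lemma poissonDl f g h x : smooth_fun f -> smooth_fun g ->
  poisson (fun y => f y + g y) h x = poisson f h x + poisson g h x.
Proof.
move=> sf sg; rewrite /poisson -big_split; apply: eq_bigr => k _ /=.
by rewrite /partial (ddirD _ (delta_mx 0 (p k)) sf sg) (ddirD _ (delta_mx 0 (q k)) sf sg)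
  !mulrDl opprD addrACA.
Qed.

Lemma poissonBl f g h x : smooth_fun f -> smooth_fun g ->
  poisson (fun y => f y - g y) h x = poisson f h x - poisson g h x.
Proof.
move=> sf sg; rewrite /poisson -sumrB; apply: eq_bigr => k _ /=.
have alg (a b c d e u : R) : (a - b) * e - (c - d) * u = (a * e - c * u) - (b * e - d * u).
  by ring.
by rewrite /partial (ddirB _ (delta_mx 0 (p k)) sf sg) (ddirB _ (delta_mx 0 (q k)) sf sg) alg.
Qed.

Lemma poissonMl f g h x : smooth_fun f -> smooth_fun g ->
  poisson (fun y => f y * g y) h x = poisson f h x * g x + f x * poisson g h x.
Proof.
move=> sf sg; rewrite /poisson mulr_suml mulr_sumr -big_split.
apply: eq_bigr => k _ /=.
rewrite /partial (ddirM _ (delta_mx 0 (p k)) sf sg) (ddirM _ (delta_mx 0 (q k)) sf sg).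
have alg (a b c d e u v w : R) : (a * v + w * c) * e - (b * v + w * d) * u =
  (a * e - b * u) * v + w * (c * e - d * u) by ring.
exact: alg.
Qed.

Lemma poisson_cstl (c : R) h x : poisson (fun=> c) h x = 0.
Proof.
by apply: big1 => k _; rewrite /partial !ddir_cst !mul0r subrr.
Qed.

Lemma poisson_suml (I : Type) (r : seq I) (F : I -> M -> R) h x :
  (forall i, smooth_fun (F i)) ->
  poisson (fun y => \sum_(i <- r) F i y) h x = \sum_(i <- r) poisson (F i) h x.
Proof.
move=> sF; elim: r => [|i r IH].
  rewrite big_nil (_ : (fun y => _) = fun=> 0) ?poisson_cstl//.
  by apply/funext => y; rewrite big_nil.
rewrite big_cons -IH -poissonDl//; last exact: smooth_fun_sum.
rewrite (_ : (fun y => \sum_(j <- i :: r) F j y) = (fun y => F i y + \sum_(j <- r) F j y))//.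
by apply/funext => y; rewrite big_cons.
Qed.

Lemma poissonDr f g h x : smooth_fun f -> smooth_fun g ->
  poisson h (fun y => f y + g y) x = poisson h f x + poisson h g x.
Proof. by move=> sf sg; rewrite poissonC poissonDl// opprD -!(poissonC h). Qed.

Lemma poissonBr f g h x : smooth_fun f -> smooth_fun g ->
  poisson h (fun y => f y - g y) x = poisson h f x - poisson h g x.
Proof. by move=> sf sg; rewrite poissonC poissonBl// (poissonC h f) (poissonC h g) opprB opprK addrC. Qed.

Lemma poissonMr f g h x : smooth_fun f -> smooth_fun g ->
  poisson h (fun y => f y * g y) x = poisson h f x * g x + f x * poisson h g x.
Proof. by move=> sf sg; rewrite poissonC poissonMl// !(poissonC h); ring. Qed.

Lemma poisson_sumr (I : Type) (r : seq I) (F : I -> M -> R) h x :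
  (forall i, smooth_fun (F i)) ->
  poisson h (fun y => \sum_(i <- r) F i y) x = \sum_(i <- r) poisson h (F i) x.
Proof.
move=> sF; rewrite poissonC poisson_suml// -sumrN.
by apply: eq_bigr => i _; rewrite -poissonC.
Qed.

(** A bracket involves g only through its first derivatives. *)
Lemma poisson_strong f g (S : set M) x : strongly_vanishes_on S g -> S x ->
  poisson f g x = 0.
Proof.
move=> H Sx; have [_ Hv] := H x Sx.
by apply: big1 => k _; rewrite /partial !Hv !mulr0 subrr.
Qed.

(** A bracket is linear in the partial derivatives of its first argument: at each point
    it is a derivative in a direction determined by g. *)
Lemma poisson_ddir g x : exists v, forall f, smooth_fun f ->
  poisson f g x = ddir f x v.
Proof.
exists (\sum_k (partial (q k) g x *: delta_mx 0 (p k) - partial (p k) g x *: delta_mx 0 (q k))).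
move=> f sf; have df := dM x sf; rewrite /ddir (derive_sumr _ df).
apply: eq_bigr => k _; set F := f \o _; set y := chart M _ _.
have E u v a b : 'D_(a *: u - b *: v) F y = a * 'D_u F y - b * 'D_v F y.
  by rewrite -scaleNr (deriveDr _ _ df) !(deriveZr _ _ df) mulNr.
by rewrite E; congr (_ - _); exact: mulrC.
Qed.

End Poisson.

(** * The bracket of the cotangent bundle and the projection mu *)

Lemma grad_near (R : realType) n (f g : 'rV[R]_n -> R) y :
  (\forall x \near y, f x = g x) -> grad f y = grad g y.
Proof. by move=> fg; apply/rowP => k; rewrite !mxE; exact: near_eq_derive. Qed.

Lemma coord_bracket_near (R : realType) N (f f' g g' : 'rV[R]_(N + N) -> R) y :
  (\forall x \near y, f x = f' x) -> (\forall x \near y, g x = g' x) ->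
  coord_bracket f g y = coord_bracket f' g' y.
Proof. by move=> ff gg; rewrite /coord_bracket (grad_near ff) (grad_near gg). Qed.

Lemma cocycle_trV (R : realType) (n : nat) (E : fibre_bundle R n) m
    (c : idx E -> idx E -> E -> 'M[R]_m) i j e : cocycle c ->
  dom E i e -> dom E j e -> (c j i e)^T *m (c i j e)^T = 1%:M.
Proof.
by move=> cc di dj; rewrite -trmx_mul (cocycle_mul cc)// (cocycle_id cc)// trmx1.
Qed.

Section Brackets.
Context {R : realType} {n : nat} (E : fibre_bundle R n).
Local Notation N := (1 + n)%N.
Let atE := total_atlas E.
Let atT := TE_atlas E.
Let atJ := J1d_atlas E.
Let ccT := change_cocycle E.
Let ccJ := vchange_cocycle E.

Lemma cdom_TE i (y : 'rV[R]_(N + N)) :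
  (chart (TE E) i @` dom (TE E) i) y <-> (chart E i @` dom E i) (lsubmx y).
Proof.
have := vector_bundle_image ccT i setT; rewrite preimage_setT !setIT.
move=> /(congr1 (fun A => A y)) H.
by rewrite -[X in X <-> _]/((chart (vector_bundle (@change R n E)) i @`
  dom (vector_bundle (@change R n E)) i) y) H.
Qed.

Lemma cdom_J1d i (y : 'rV[R]_(N + n)) :
  (chart (J1d E) i @` dom (J1d E) i) y <-> (chart E i @` dom E i) (lsubmx y).
Proof.
have := vector_bundle_image ccJ i setT; rewrite preimage_setT !setIT.
move=> /(congr1 (fun A => A y)) H.
by rewrite -[X in X <-> _]/((chart (vector_bundle (@vchange R n E)) i @`
  dom (vector_bundle (@vchange R n E)) i) y) H.
Qed.

Lemma brT_chart_at (f g : TE E -> R) a :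
  brT f g a = coord_bracket (f \o unchart (TE E) (chart_at E a.1))
                 (g \o unchart (TE E) (chart_at E a.1))
                 (chart (TE E) (chart_at E a.1) a).
Proof. by rewrite coord_bracketE. Qed.

(** The bracket at a point may be computed in any chart around it: transition maps
    are cotangent lifts of transition maps of E. *)
Lemma brT_chart (f g : TE E -> R) i a : smooth_fun f -> smooth_fun g ->
  dom E i a.1 ->
  brT f g a = coord_bracket (f \o unchart (TE E) i) (g \o unchart (TE E) i) (chart (TE E) i a).
Proof.
move=> sf sg di; rewrite brT_chart_at; set i0 := chart_at E a.1.
have d0 : dom E i0 a.1 by exact: (at_chart_at atE).
pose T := chart (TE E) i \o unchart (TE E) i0; set y0 := chart (TE E) i0 a.
have Ty0 : T y0 = chart (TE E) i a.
  exact: (congr1 (chart (TE E) i) (@at_chartK _ _ _ atT i0 a d0)).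
have fT : \forall y \near y0, (f \o unchart (TE E) i0) y = ((f \o unchart (TE E) i) \o T) y.
  exact: (near_transition atT).
have gT : \forall y \near y0, (g \o unchart (TE E) i0) y = ((g \o unchart (TE E) i) \o T) y.
  exact: (near_transition atT).
have dT : differentiable T y0 by exact: (@differentiable_transition _ _ _ atT i0 i a d0 di).
have df : differentiable (f \o unchart (TE E) i) (T y0).
  by rewrite Ty0; exact: (smooth_fun_diff sf).
have dg : differentiable (g \o unchart (TE E) i) (T y0).
  by rewrite Ty0; exact: (smooth_fun_diff sg).
suff ST : ('J T y0)^T *m symplectic_mx *m 'J T y0 = symplectic_mx.
  apply: (etrans (coord_bracket_near fT gT)); rewrite -Ty0.
  exact: (coord_bracket_symplectic dT df dg ST).
pose W := chart (TE E) i0 @` (dom (TE E) i0 `&` dom (TE E) i).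
have WE : W = [set y | (chart E i0 @` (dom E i0 `&` dom E i)) (lsubmx y)].
  exact: vector_bundle_overlap ccT i0 i.
apply: (@cotangent_lift _ _ W (chart E i0 @` (dom E i0 `&` dom E i)) T
  (chart E i \o unchart E i0)).
- exact: (at_open atT).
- exact: (ex_intro2 _ _ a (conj d0 di) erefl).
- exact: (at_open atE).
- by move=> y; rewrite WE.
- exact: (at_transition atT).
- exact: (at_transition atE).
- move=> y; rewrite WE => /(unchartP atE)[d1 d2 _].
  by rewrite [T y](vector_bundle_transition ccT d1 d2) row_mxKl.
- move=> y; rewrite WE => /(unchartP atE)[d1 d2 yE].
  rewrite [T y](vector_bundle_transition ccT d1 d2) row_mxKr.
  have -> : 'J (chart E i \o unchart E i0) (lsubmx y) =
    change i0 i (unchart E i0 (lsubmx y)) by rewrite /change yE.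
  by rewrite -mulmxA (cocycle_trV ccT d1 d2) mulmx1.
Qed.

Lemma smooth_brT (f g : TE E -> R) : smooth_fun f -> smooth_fun g ->
  smooth_fun (brT f g).
Proof.
move=> sf sg i; have oW : open (chart (TE E) i @` dom (TE E) i) by exact: (open_cdom atT).
apply: (smooth_eq oW _ (smooth_coord_bracket oW (sf i) (sg i))) => y.
rewrite inE => /(cdomP atT)[d yE]; rewrite [RHS](brT_chart sf sg d).
by rewrite yE.
Qed.

Lemma brT_jacobi (f g h : TE E -> R) a :
  smooth_fun f -> smooth_fun g -> smooth_fun h ->
  brT (brT f g) h a + brT (brT h f) g a + brT (brT g h) f a = 0.
Proof.
move=> sf sg sh; set i := chart_at E a.1.
have di : dom E i a.1 by exact: (at_chart_at atE).
have oW : open (chart (TE E) i @` dom (TE E) i) by exact: (open_cdom atT).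
have near_br (u v w : TE E -> R) : smooth_fun u -> smooth_fun v -> smooth_fun w ->
    brT (brT u v) w a = coord_bracket (coord_bracket (u \o unchart (TE E) i) (v \o unchart (TE E) i))
       (w \o unchart (TE E) i) (chart (TE E) i a).
  move=> su sv sw; rewrite brT_chart_at -/i; apply: coord_bracket_near; last first.
    by apply: filterS (near_cdom atT di) => y _.
  apply: filterS (near_cdom atT di) => y /(cdomP atT)[d yE] /=.
  by rewrite (brT_chart su sv d) yE.
rewrite !near_br//; apply: (coord_bracket_jacobi oW); [by exists a|exact: sf|exact: sg|exact: sh].
Qed.

(** The expression of mu in adapted charts: it forgets the momentum u conjugate to t. *)
Definition mu_coord (y : 'rV[R]_(N + N)) : 'rV[R]_(N + n) :=
  row_mx (lsubmx y) (rsubmx (rsubmx y : 'rV[R]_(1 + n))).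

Definition mu_coord_section (x : 'rV[R]_(N + n)) : 'rV[R]_(N + N) :=
  row_mx (lsubmx x) (row_mx (0 : 'rV[R]_1) (rsubmx x)).

Lemma mu_coord_sectionK x : mu_coord (mu_coord_section x) = x.
Proof. by rewrite /mu_coord /mu_coord_section row_mxKl !row_mxKr hsubmxK. Qed.

(** Restriction to vertical vectors commutes with changes of chart because dt is the
    same covector in all charts. *)
Lemma restrict_change i j e (p : 'rV[R]_N) : dom E i e -> dom E j e ->
  rsubmx (p *m (change i j e)^T : 'rV[R]_(1 + n)) = rsubmx p *m (vchange i j e)^T.
Proof.
move=> di dj; rewrite (change_block di dj) tr_block_mx -{1}[p](@hsubmxK _ 1 1 n).
rewrite mul_row_block row_mxKr trmx0 mulmx0 add0r.
by congr (_ *m _^T).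
Qed.

Lemma chart_mu i (a : TE E) : dom E i a.1 ->
  chart (J1d E) i (mu a) = mu_coord (chart (TE E) i a).
Proof.
move=> di; have d0 := at_chart_at atE a.1.
by rewrite /mu_coord row_mxKl row_mxKr restrict_change.
Qed.

Lemma mu_unchart i y : (chart (TE E) i @` dom (TE E) i) y ->
  mu (unchart (TE E) i y) = unchart (J1d E) i (mu_coord y).
Proof.
move=> /(cdomP atT)[d yE]; rewrite -[in RHS]yE -chart_mu//.
by rewrite (at_chartK atJ).
Qed.

Lemma cdom_mu_coord i y : (chart (TE E) i @` dom (TE E) i) y ->
  (chart (J1d E) i @` dom (J1d E) i) (mu_coord y).
Proof. by move=> /cdom_TE H; apply/cdom_J1d; rewrite row_mxKl. Qed.

Lemma cdom_mu_coord_section i x : (chart (J1d E) i @` dom (J1d E) i) x ->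
  (chart (TE E) i @` dom (TE E) i) (mu_coord_section x).
Proof. by move=> /cdom_J1d H; apply/cdom_TE; rewrite row_mxKl. Qed.

Lemma smooth_mu_coord W k : open W -> smooth W (fun y => mu_coord y 0 k).
Proof.
move=> oW; rewrite /mu_coord; case: (split_ordP k) => b ->.
  by apply: (smooth_eq oW _ (smooth_coord (lshift N b) oW)) => y _; rewrite row_mxEl mxE.
apply: (smooth_eq oW _ (smooth_coord (rshift N (rshift 1 b)) oW)) => y _.
by rewrite row_mxEr !mxE.
Qed.

Lemma smooth_mu_coord_section W k : open W -> smooth W (fun x => mu_coord_section x 0 k).
Proof.
move=> oW; rewrite /mu_coord_section; case: (split_ordP k) => b ->.
  by apply: (smooth_eq oW _ (smooth_coord (lshift n b) oW)) => y _; rewrite row_mxEl mxE.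
case: (split_ordP b) => c ->.
  by apply: (smooth_eq oW _ (smooth_cst 0 oW)) => y _; rewrite row_mxEr row_mxEl mxE.
apply: (smooth_eq oW _ (smooth_coord (rshift N c) oW)) => y _.
by rewrite !row_mxEr !mxE.
Qed.

Lemma smooth_mu (f : J1d E -> R) : smooth_fun f -> smooth_fun (f \o @mu R n E).
Proof.
move=> sf i; have oW : open (chart (TE E) i @` dom (TE E) i) by exact: (open_cdom atT).
have H : smooth (chart (TE E) i @` dom (TE E) i) ((f \o unchart (J1d E) i) \o mu_coord).
  apply: (smooth_comp oW _ (sf i)); first exact: cdom_mu_coord.
  by move=> k; exact: smooth_mu_coord.
by apply: (smooth_eq oW _ H) => y; rewrite inE => cy /=; rewrite mu_unchart.
Qed.

(** mu has the smooth local sections u = 0. *)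
Lemma smooth_of_mu (f : J1d E -> R) : smooth_fun (f \o @mu R n E) -> smooth_fun f.
Proof.
move=> sf i; have oW : open (chart (J1d E) i @` dom (J1d E) i) by exact: (open_cdom atJ).
have H : smooth (chart (J1d E) i @` dom (J1d E) i)
    (((f \o @mu R n E) \o unchart (TE E) i) \o mu_coord_section).
  apply: (smooth_comp oW _ (sf i)); first exact: cdom_mu_coord_section.
  by move=> k; exact: smooth_mu_coord_section.
apply: (smooth_eq oW _ H) => y; rewrite inE => cy /=.
by rewrite (mu_unchart (cdom_mu_coord_section cy)) mu_coord_sectionK.
Qed.

End Brackets.

(** * Hamiltonian sections *)

Section Mu.
Context {R : realType} {n : nat} (E : fibre_bundle R n).
Local Notation N := (1 + n)%N.
Let atE := total_atlas E.
Let atT := TE_atlas E.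
Let atJ := J1d_atlas E.
Local Notation mu := (@mu R n E).

Lemma brTE (f g : TE E -> R) : brT f g = poisson (lshift N) (@rshift N N) f g.
Proof. by []. Qed.

Lemma derive_mu_coord (v y : 'rV[R]_(N + N)) :
  'D_v (@mu_coord R n) y = mu_coord v /\ differentiable (@mu_coord R n) y.
Proof.
have d : differentiable (@mu_coord R n) y.
  by apply: differentiable_rV => k; apply: (smooth_diff (smooth_mu_coord k openT)).
split=> //; apply/rowP => k; rewrite (derive_coord _ _ d).
rewrite /mu_coord; case: (split_ordP k) => b ->.
  rewrite row_mxEl mxE -[RHS](derive_proj y); congr ('D_v _ y).
  by apply/funext => x; rewrite row_mxEl mxE.
rewrite row_mxEr !mxE -[RHS](derive_proj y); congr ('D_v _ y).
by apply/funext => x; rewrite row_mxEr !mxE.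
Qed.

Lemma derive_mu (f : J1d E -> R) i (a : TE E) v : smooth_fun f -> dom E i a.1 ->
  'D_v ((f \o mu) \o unchart (TE E) i) (chart (TE E) i a) =
  'D_(mu_coord v) (f \o unchart (J1d E) i) (chart (J1d E) i (mu a)).
Proof.
move=> sf di; have [Dp dp] := derive_mu_coord v (chart (TE E) i a).
have df : differentiable (f \o unchart (J1d E) i) (mu_coord (chart (TE E) i a)).
  by rewrite -(chart_mu di); exact: (smooth_fun_diff sf).
have H : \forall y \near chart (TE E) i a, ((f \o mu) \o unchart (TE E) i) y =
    ((f \o unchart (J1d E) i) \o (@mu_coord R n)) y.
  apply: (filterS _ (@near_cdom _ _ _ atT i a di)) => y cy.
  exact: (congr1 f (mu_unchart cy)).
apply: (etrans (near_eq_derive _ H)); apply: (etrans (derive_comp _ dp df)).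
by rewrite Dp (chart_mu di).
Qed.

Lemma mu_coord_base k : mu_coord (delta_mx 0 (lshift N k)) = delta_mx 0 (lshift n k) :> 'rV[R]_(N + n).
Proof.
apply/rowP => j; rewrite /mu_coord mxE; case: (split_ordP j) => b ->.
  by rewrite mxE !mxE/= !eq_lshift.
by rewrite !mxE/= eq_rlshift eq_rlshift.
Qed.

Lemma mu_coord_fibre k : mu_coord (delta_mx 0 (rshift N (rshift 1 k))) =
  delta_mx 0 (rshift N k) :> 'rV[R]_(N + n).
Proof.
apply/rowP => j; rewrite /mu_coord mxE; case: (split_ordP j) => b ->.
  by rewrite mxE !mxE/= !eq_lrshift.
by rewrite !mxE/= !eq_rshift.
Qed.

Lemma mu_coord_u : mu_coord (delta_mx 0 (rshift N (lshift n ord0))) = 0 :> 'rV[R]_(N + n).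
Proof.
apply/rowP => j; rewrite /mu_coord [RHS]mxE; case: (split_ordP j) => b ->.
  by rewrite row_mxEl !mxE/= eq_lrshift.
by rewrite row_mxEr !mxE/= eq_rshift eq_rlshift.
Qed.

Lemma partial_mu (f : J1d E -> R) (a : TE E) k : smooth_fun f ->
  partial k (f \o mu) a = ddir f (mu a) (mu_coord (delta_mx 0 k)).
Proof. by move=> sf; exact: (derive_mu (delta_mx 0 k) sf (at_chart_at atE a.1)). Qed.

(** A function pulled back by mu does not depend on u, so the pair (t, u) contributes
    nothing to the bracket. *)
Lemma brT_mu (f g : J1d E -> R) (a : TE E) : smooth_fun f -> smooth_fun g ->
  brT (f \o mu) (g \o mu) a = brJ f g (mu a).
Proof.
move=> sf sg; rewrite /brT big_split_ord/= big_ord1.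
rewrite !(partial_mu _ _ sf) !(partial_mu _ _ sg) mu_coord_u.
have d0 (h : J1d E -> R) z : ddir h z 0 = 0 by rewrite /ddir derive0.
rewrite !d0 mulr0 mul0r subrr add0r /brJ; apply: eq_bigr => k _.
rewrite !(partial_mu _ _ sf) !(partial_mu _ _ sg).
by rewrite (mu_coord_base (rshift 1 k)) mu_coord_fibre.
Qed.

Lemma smooth_brJ (f g : J1d E -> R) : smooth_fun f -> smooth_fun g ->
  smooth_fun (brJ f g).
Proof.
move=> sf sg; apply: smooth_of_mu.
have -> : brJ f g \o mu = brT (f \o mu) (g \o mu).
  by apply/funext => a; rewrite /= brT_mu.
by apply: smooth_brT; exact: smooth_mu.
Qed.

Section Ham.
Variable L : J1 E -> R.

Lemma hs_base h z : ham_section L h -> (h z).1 = z.1.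
Proof. by move=> hh; have := hs_section hh z => /(congr1 fst). Qed.

Lemma hs_momentum h z : ham_section L h -> rsubmx ((h z).2 : 'rV[R]_(1 + n)) = z.2.
Proof. by move=> hh; have := hs_section hh z => /(congr1 snd). Qed.

Definition ucoord : 'I_(N + N) := rshift N (lshift n ord0).

(** Multiples of dt have the same components in all charts. *)
Lemma dt_change i j e (c : R) : dom E i e -> dom E j e ->
  row_mx c%:M (0 : 'rV[R]_n) *m (change i j e)^T = row_mx c%:M 0.
Proof.
move=> di dj; rewrite (change_block di dj) tr_block_mx mul_row_block.
by rewrite mul0mx addr0 trmx1 mulmx1 mul0mx trmx0 mulmx0 addr0.
Qed.

Lemma hstar_diff h (a : TE E) : ham_section L h ->
  a.2 - (h (mu a)).2 = row_mx (hstar h a)%:M 0 :> 'rV[R]_(1 + n).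
Proof.
move=> hh; rewrite -[LHS]hsubmxK; congr row_mx.
  by rewrite [LHS]mx11_scalar.
by rewrite linearB/= (hs_momentum _ hh) subrr.
Qed.

(** The difference of a point of T^*E and of h at its projection is a multiple of dt, so
    its u-component may be read in any chart. *)
Lemma hstar_chart h i (a : TE E) : ham_section L h -> dom E i a.1 ->
  hstar h a = chart (TE E) i a 0 ucoord - chart (TE E) i (h (mu a)) 0 ucoord.
Proof.
move=> hh di; have d0 := at_chart_at atE a.1.
have := dt_change (hstar h a) di d0; rewrite -(hstar_diff a hh) mulmxBl.
move=> /(congr1 (fun p : 'rV[R]_(1 + n) => p 0 (lshift n ord0))).
have -> : (a.2 - (h (mu a)).2 : 'rV[R]_(1 + n)) 0 (lshift n ord0) = hstar h a.
  by rewrite /hstar [RHS]mxE.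
move=> <-; rewrite mxE; congr (_ + _); first by rewrite row_mxEr.
by rewrite mxE row_mxEr (hs_base _ hh).
Qed.

Lemma smooth_ham_component h i k : ham_section L h ->
  smooth (chart (J1d E) i @` dom (J1d E) i)
         (fun x => chart (TE E) i (h (unchart (J1d E) i x)) 0 k).
Proof.
move=> hh; have [_ /(_ k)] := hs_smooth hh i i; rewrite /= setIT.
congr (smooth (_ @` _) _); apply/seteqP; split=> [z []//|z dz]; split=> //.
by rewrite /= (hs_base _ hh).
Qed.

Lemma hstar_unchart h i y : ham_section L h -> (chart (TE E) i @` dom (TE E) i) y ->
  hstar h (unchart (TE E) i y) =
  y 0 ucoord - chart (TE E) i (h (unchart (J1d E) i (mu_coord y))) 0 ucoord.
Proof.
move=> hh cy; have [d yE] := cdomP atT cy.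
by rewrite (hstar_chart hh d) (mu_unchart cy) yE.
Qed.

Lemma smooth_hstar h : ham_section L h -> smooth_fun (hstar h).
Proof.
move=> hh i; have oW : open (chart (TE E) i @` dom (TE E) i) by exact: (open_cdom atT).
have H : smooth (chart (TE E) i @` dom (TE E) i) (fun y => y 0 ucoord -
    ((fun x => chart (TE E) i (h (unchart (J1d E) i x)) 0 ucoord) \o (@mu_coord R n)) y).
  apply: (smoothB oW); first exact: smooth_coord.
  apply: (smooth_comp oW _ (smooth_ham_component i ucoord hh)); first exact: cdom_mu_coord.
  by move=> k; exact: smooth_mu_coord.
by apply: (smooth_eq oW _ H) => y; rewrite inE => cy; rewrite [RHS](hstar_unchart hh cy).
Qed.

Lemma ddir_hstar h (a : TE E) v : ham_section L h ->
  ddir (hstar h) a v = v 0 ucoord -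
   'D_(mu_coord v) (fun x => chart (TE E) (chart_at E a.1) (h (unchart (J1d E) (chart_at E a.1) x)) 0 ucoord)
     (chart (J1d E) (chart_at E a.1) (mu a)).
Proof.
move=> hh; set i := chart_at E a.1.
have di : dom E i a.1 by exact: (at_chart_at atE).
set k := fun x => chart (TE E) i _ 0 ucoord.
have [Dp dp] := derive_mu_coord v (chart (TE E) i a).
have dk : differentiable k (mu_coord (chart (TE E) i a)).
  rewrite -(chart_mu di); apply: (smooth_diff (smooth_ham_component i ucoord hh)).
  exact: (ex_intro2 _ _ (mu a) di erefl).
have H : \forall y \near chart (TE E) i a, (hstar h \o unchart (TE E) i) y =
    y 0 ucoord - (k \o (@mu_coord R n)) y.
  apply: (filterS _ (@near_cdom _ _ _ atT i a di)) => y cy.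
  exact: hstar_unchart.
apply: (etrans (near_eq_derive _ H)).
have d1 : derivable (fun y : 'rV[R]_(N + N) => y 0 ucoord) (chart (TE E) i a) v.
  exact/diff_derivable/differentiable_coord.
have d2 : derivable (k \o (@mu_coord R n)) (chart (TE E) i a) v.
  exact/diff_derivable/(differentiable_comp dp dk).
apply: (etrans (deriveB d1 d2)); rewrite derive_proj (derive_comp _ dp dk) Dp.
by rewrite (chart_mu di).
Qed.

(** In a chart hstar h is u + H with H a function on J^1pi^*, so that the derivatives of
    hstar h and of mu^*f are constant along the fibres of mu. This is why evaluating
    at the point h z of the fibre, as [Xh] does, gives mu^*(X_h f). *)
Lemma brT_hstar h (f : J1d E -> R) (a : TE E) : ham_section L h -> smooth_fun f ->
  brT (f \o mu) (hstar h) a = Xh h f (mu a).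
Proof.
move=> hh sf; rewrite /Xh /brT.
have mE : mu (h (mu a)) = mu a by exact: (hs_section hh).
have bE : (h (mu a)).1 = a.1 by rewrite (hs_base _ hh).
apply: eq_bigr => k _; rewrite !(partial_mu _ _ sf) mE /partial !(ddir_hstar _ _ hh).
by rewrite mE bE.
Qed.

Lemma smooth_Xh h (f : J1d E -> R) : ham_section L h -> smooth_fun f ->
  smooth_fun (Xh h f).
Proof.
move=> hh sf; apply: smooth_of_mu.
have -> : Xh h f \o mu = brT (f \o mu) (hstar h).
  by apply/funext => a; rewrite /= brT_hstar.
by apply: smooth_brT; [exact: smooth_mu|exact: smooth_hstar].
Qed.

Lemma Xh_ddir h z : ham_section L h ->
  exists v, forall f, smooth_fun f -> Xh h f z = ddir f z v.
Proof.
move=> hh; have [w Hw] := poisson_ddir atT (lshift N) (@rshift N N) (hstar h) (h z).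
exists (mu_coord w) => f sf; rewrite /Xh brTE Hw; last exact: smooth_mu.
have di : dom E (chart_at E (h z).1) (h z).1 by exact: (at_chart_at atE).
by rewrite /ddir (derive_mu w sf di) (hs_section hh z) (hs_base _ hh).
Qed.

Lemma hstar_sub h h' (a : TE E) : ham_section L h -> ham_section L h' ->
  hstar h a - hstar h' a = hstar h (h' (mu a)).
Proof.
move=> hh hh'; have di := at_chart_at atE a.1.
rewrite (hstar_chart hh di) (hstar_chart hh' di) (hstar_chart (i := chart_at E a.1) hh); last first.
  by rewrite (hs_base _ hh').
rewrite (hs_section hh').
have alg (x y z : R) : x - y - (x - z) = z - y by ring.
exact: alg.
Qed.

(** The Legendre condition forces h and h' to agree on the range of [FL]. *)
Lemma ham_diff h h' : ham_section L h -> ham_section L h' ->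
  exists psi, primary L psi /\ forall a, hstar h a = hstar h' a + psi (mu a).
Proof.
move=> hh hh'; exists (fun z => hstar h (h' z)); split; last first.
  by move=> a; rewrite -hstar_sub// subrKC.
split.
  apply: smooth_of_mu.
  have -> : (fun z => hstar h (h' z)) \o mu = (fun a => hstar h a - hstar h' a).
    by apply/funext => a; rewrite hstar_sub.
  by apply: (smooth_funB atT); exact: smooth_hstar.
move=> _ [w _ <-]; rewrite -(hs_legendre hh') (hs_legendre hh).
by rewrite /hstar (hs_section hh) subrr !mxE.
Qed.

(** The section called h + psi: the sign is that of hstar, which is u + H where the
    section is (t, q, - H, p). *)
Definition ham_shift (h : J1d E -> TE E) (psi : J1d E -> R) : J1d E -> TE E :=
  fun z => (z.1, (h z).2 - row_mx (psi z)%:M 0).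

Lemma chart_ham_shift h psi j z k : ham_section L h -> dom E j z.1 ->
  chart (TE E) j (ham_shift h psi z) 0 k =
  chart (TE E) j (h z) 0 k - psi z * (k == ucoord)%:R.
Proof.
move=> hh dj; have d0 := at_chart_at atE z.1.
rewrite /= (hs_base _ hh) mulmxBl (dt_change _ dj d0) /ucoord.
case: (split_ordP k) => b ->; first by rewrite !row_mxEl eq_lrshift mulr0 subr0.
rewrite !row_mxEr mxE [X in _ + X]mxE eq_rshift; congr (_ - _).
case: (split_ordP b) => c ->.
  by rewrite row_mxEl [c]ord1 mxE !eqxx mulr1.
by rewrite row_mxEr mxE eq_rlshift mulr0.
Qed.

Lemma ham_shift_section h psi : ham_section L h -> primary L psi ->
  ham_section L (ham_shift h psi).
Proof.
move=> hh [spsi psi0]; split.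
- move=> i j W.
  have [oW sW] := hs_smooth hh i j.
  have WE : W = chart (J1d E) i @` (dom (J1d E) i `&` setT `&` h @^-1` dom (TE E) j).
    by rewrite /W; congr (_ @` (_ `&` _)); apply/seteqP; split=> z /=; rewrite (hs_base _ hh).
  split=> [|k]; first by rewrite WE.
  rewrite -WE in oW sW.
  have WS : W `<=` chart (J1d E) i @` dom (J1d E) i by move=> _ [z [[dz _] _] <-]; exists z.
  have sp : smooth W (psi \o unchart (J1d E) i) by apply: (smooth_sub WS); exact: spsi.
  have H := smoothB oW (sW k) (smoothM oW sp (smooth_cst (k == ucoord)%:R oW)).
  apply: (smooth_eq oW _ H) => x; rewrite inE => -[z [[dz _] djz] xE].
  have zE := @at_chartK _ _ _ atJ i z dz.
  have dz' : dom E j (unchart (J1d E) i x).1 by rewrite -xE zE.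
  exact: esym (chart_ham_shift psi k hh dz').
- by move=> [e p]; rewrite /mu/= linearB/= row_mxKr subr0 (hs_momentum _ hh).
- move=> w; rewrite /ham_shift psi0; last by exists w.
  by rewrite -(hs_legendre hh) raddf0 row_mx0 subr0.
Qed.

Lemma hstar_ham_shift h psi a : ham_section L h ->
  hstar (ham_shift h psi) a = hstar h a + psi (mu a).
Proof.
by move=> hh; rewrite /hstar /ham_shift /= opprB addrCA addrC linearD/= row_mxKl !mxE eqxx mulr1n.
Qed.

Lemma Xh_add h h' psi f z : ham_section L h -> ham_section L h' -> smooth_fun psi ->
  (forall a, hstar h' a = hstar h a + psi (mu a)) -> smooth_fun f ->
  Xh h' f z = Xh h f z + brJ f psi z.
Proof.
move=> hh hh' sp E' sf; rewrite {1}/Xh.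
have -> : hstar h' = (fun a => hstar h a + (psi \o mu) a) by apply/funext.
rewrite brTE (poissonDr atT); [|exact: smooth_hstar|exact: smooth_mu].
have B1 := brT_hstar (h' z) hh sf; rewrite (hs_section hh') in B1.
have B2 := brT_mu (h' z) sf sp; rewrite (hs_section hh') in B2.
exact: (congr2 +%R B1 B2).
Qed.

End Ham.
End Mu.

(** * Extending a kernel vector of a matrix of constant rank *)

Section KernelExtension.
Context {R : realType} {N : nat} (M : charted_space R N) (atM : smooth_atlas M).

Lemma smooth_fun_det r (A : M -> 'M[R]_r) :
  (forall i j, smooth_fun (fun w => A w i j)) -> smooth_fun (fun w => \det (A w)).
Proof.
move=> sA; rewrite /determinant; apply: (smooth_fun_sum atM) => s _.
apply: (smooth_funM atM); first exact: smooth_fun_cst.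
by apply: (smooth_fun_prod atM) => i _; exact: sA.
Qed.

Lemma smooth_fun_mulmx r s t (A : M -> 'M[R]_(r, s)) (B : M -> 'M[R]_(s, t)) :
  (forall i j, smooth_fun (fun w => A w i j)) ->
  (forall i j, smooth_fun (fun w => B w i j)) ->
  forall i j, smooth_fun (fun w => (A w *m B w) i j).
Proof.
move=> sA sB i j.
have -> : (fun w => (A w *m B w) i j) = (fun w => \sum_k A w i k * B w k j).
  by apply/funext => w; rewrite mxE.
by apply: (smooth_fun_sum atM) => k _; exact: smooth_funM.
Qed.

Lemma smooth_fun_adj r (A : M -> 'M[R]_r) :
  (forall i j, smooth_fun (fun w => A w i j)) ->
  forall i j, smooth_fun (fun w => (\adj (A w)) i j).
Proof.
move=> sA i j.
have -> : (fun w => (\adj (A w)) i j) =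
    (fun w => (-1) ^+ (j + i) * \det (row' j (col' i (A w)))).
  by apply/funext => w; rewrite mxE.
apply: (smooth_funM atM); first exact: smooth_fun_cst.
apply: smooth_fun_det => k l.
have -> : (fun w => row' j (col' i (A w)) k l) = (fun w => A w (lift j k) (lift i l)).
  by apply/funext => w; rewrite !mxE.
exact: sA.
Qed.

(** Cramer's rule: since the rank is r on S, near z the rows of C w are combinations of r
    chosen ones, with coefficients that are rational in C w. Multiplying by the minor
    d w in the denominators makes the projection of v onto the kernel polynomial in C w,
    hence globally smooth; the additional factor d w makes it 0 where the minor vanishes. *)
Lemma kernel_extension m (S : set M) (C : M -> 'M[R]_m) (r : nat) z (v : 'rV[R]_m) :
  (forall i j, smooth_fun (fun w => C w i j)) ->
  (forall w, S w -> \rank (C w) = r) -> S z -> v *m C z = 0 ->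
  exists kappa : M -> 'rV[R]_m,
    [/\ forall i, smooth_fun (fun w => kappa w 0 i),
        forall w, S w -> kappa w *m C w = 0 & kappa z = v].
Proof.
move=> sC rC Sz vC.
(* P and Q cut out of C z an r x r block equal to the identity; A w is the same
   block of C w, and d w its determinant. *)
have [P [Q PQ]] : exists (P : 'M[R]_(r, m)) (Q : 'M[R]_(m, r)), P *m C z *m Q = 1%:M.
  exists (pid_mx r *m invmx (col_ebase (C z))), (invmx (row_ebase (C z)) *m pid_mx r).
  have := mulmx_ebase (C z); rewrite (rC _ Sz).
  have := col_ebase_unit (C z); have := row_ebase_unit (C z).
  move: (col_ebase (C z)) (row_ebase (C z)) => X Y uY uX <-.
  have rm : (r <= m)%N by rewrite -(rC _ Sz) rank_leq_row.
  rewrite !mulmxA mulmxKV// mulmxK//.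
  by rewrite !pid_mx_id // pid_mx_1.
pose A w := P *m C w *m Q; pose d w := \det (A w).
pose kappa w := d w *: (d w *: v - v *m C w *m Q *m \adj (A w) *m P).
have scst s t (B : 'M[R]_(s, t)) i j : smooth_fun (fun _ : M => B i j) by exact: smooth_fun_cst.
have sA i j : smooth_fun (fun w => A w i j).
  by do 2 apply: smooth_fun_mulmx => // ? ?.
have sd : smooth_fun d by exact: smooth_fun_det.
exists kappa; split.
- move=> i.
  have -> : (fun w => kappa w 0 i) = (fun w => d w * (d w * v 0 i -
      (v *m C w *m Q *m \adj (A w) *m P) 0 i)).
    by apply/funext => w; rewrite !mxE.
  apply: (smooth_funM atM) => //; apply: (smooth_funB atM).
    by apply: (smooth_funM atM) => //; exact: smooth_fun_cst.
  apply: smooth_fun_mulmx => // {}i j; apply: smooth_fun_mulmx => [k l|k l]; last exact: smooth_fun_adj.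
  by do 2 apply: smooth_fun_mulmx => // ? ?.
- move=> w Sw; have [d0|dn0] := eqVneq (d w) 0.
    by rewrite /kappa d0 scale0r mul0mx.
  have uA : A w \in unitmx by rewrite unitmxE unitfE.
  (* Where d w != 0 the r rows P C w are independent, so by constancy of the rank
     they span the row space of C w. *)
  have : (C w <= P *m C w)%MS.
    rewrite -(geq_leqif (mxrank_leqif_sup (submxMl P (C w)))) (rC _ Sw).
    by rewrite -{1}(mxrank_unit uA) mxrankM_maxl.
  move=> CPC; have /submxP[y yE] : (v *m C w <= P *m C w)%MS.
    by apply: submx_trans CPC; exact: submxMl.
  have adjE : \adj (A w) = d w *: invmx (A w).
    by rewrite /invmx uA scalerA mulfV// scale1r.
  have key : v *m C w *m Q *m invmx (A w) *m P *m C w = v *m C w.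
    have yA : y *m (P *m C w) *m Q = y *m A w by rewrite /A !mulmxA.
    by rewrite yE yA (mulmxK uA) mulmxA.
  rewrite /kappa adjE -scalemxAl mulmxBl -scalemxAr -!scalemxAl key.
  by rewrite subrr scaler0.
- have dz : d z = 1 by rewrite /d /A PQ det1.
  by rewrite /kappa dz !scale1r vC !mul0mx subr0.
Qed.

End KernelExtension.

(** * Bracket calculus and constraints *)

Section Algebra.
Context {R : realType} {n : nat} (E : fibre_bundle R n).
Local Notation mu := (@mu R n E).
Let atT := TE_atlas E.
Let atJ := J1d_atlas E.

Section OnTE.
Implicit Types F G K : TE E -> R.

Lemma brTC F G a : brT F G a = - brT G F a.
Proof. exact: poissonC. Qed.

Lemma brTDr F G K a : smooth_fun G -> smooth_fun K ->
  brT F (fun x => G x + K x) a = brT F G a + brT F K a.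
Proof. exact: (poissonDr atT). Qed.

Lemma brTBr F G K a : smooth_fun G -> smooth_fun K ->
  brT F (fun x => G x - K x) a = brT F G a - brT F K a.
Proof. exact: (poissonBr atT). Qed.

Lemma brTNl F G a : smooth_fun F -> brT (fun x => - F x) G a = - brT F G a.
Proof.
move=> sF; have -> : (fun x => - F x) = (fun x => (fun=> 0) x - F x).
  by apply/funext => x; rewrite sub0r.
rewrite [LHS](poissonBl atT) ?poisson_cstl ?sub0r//.
exact: (smooth_fun_cst atT).
Qed.

(** The Jacobi identity, read as the commutator of the Hamiltonian vector fields of K
    and G applied to F. *)
Lemma brT_commutator F G K a : smooth_fun F -> smooth_fun G -> smooth_fun K ->
  brT (brT F K) G a - brT (brT F G) K a = - brT F (brT G K) a.
Proof.
move=> sF sG sK; have := brT_jacobi a sF sK sG.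
have E1 : brT (brT G F) K a = - brT (brT F G) K a.
  rewrite -brTNl; last exact: smooth_brT.
  by congr (brT _ K a); apply/funext => x; exact: brTC.
have E2 : brT (brT K G) F a = brT F (brT G K) a.
  rewrite [RHS]brTC -brTNl; last exact: smooth_brT.
  by congr (brT _ F a); apply/funext => x; exact: brTC.
by rewrite E1 E2 => /eqP; rewrite addr_eq0 => /eqP.
Qed.

End OnTE.

Section OnJ1d.
Implicit Types f g h : J1d E -> R.

Lemma brJC f g z : brJ f g z = - brJ g f z.
Proof. exact: poissonC. Qed.

Lemma brJDl f g h z : smooth_fun f -> smooth_fun g ->
  brJ (fun x => f x + g x) h z = brJ f h z + brJ g h z.
Proof. exact: (poissonDl atJ). Qed.

Lemma brJBl f g h z : smooth_fun f -> smooth_fun g ->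
  brJ (fun x => f x - g x) h z = brJ f h z - brJ g h z.
Proof. exact: (poissonBl atJ). Qed.

Lemma brJBr f g h z : smooth_fun f -> smooth_fun g ->
  brJ h (fun x => f x - g x) z = brJ h f z - brJ h g z.
Proof. exact: (poissonBr atJ). Qed.

Lemma brJMl f g h z : smooth_fun f -> smooth_fun g ->
  brJ (fun x => f x * g x) h z = brJ f h z * g z + f z * brJ g h z.
Proof. exact: (poissonMl atJ). Qed.

Lemma brJMr f g h z : smooth_fun f -> smooth_fun g ->
  brJ h (fun x => f x * g x) z = brJ h f z * g z + f z * brJ h g z.
Proof. exact: (poissonMr atJ). Qed.

Lemma brJ_cstl (c : R) h z : brJ (fun=> c) h z = 0.
Proof. exact: poisson_cstl. Qed.

Lemma brJ_suml l (F : 'I_l -> J1d E -> R) h z : (forall i, smooth_fun (F i)) ->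
  brJ (fun x => \sum_(i < l) F i x) h z = \sum_(i < l) brJ (F i) h z.
Proof. exact: (poisson_suml atJ). Qed.

Lemma brJ_sumr l (F : 'I_l -> J1d E -> R) h z : (forall i, smooth_fun (F i)) ->
  brJ h (fun x => \sum_(i < l) F i x) z = \sum_(i < l) brJ h (F i) z.
Proof. exact: (poisson_sumr atJ). Qed.

(** At a common zero of the chi the terms with derivatives of the coefficients drop. *)
Lemma brJ_combr l (lam chi : 'I_l -> J1d E -> R) h z :
  (forall i, smooth_fun (lam i)) -> (forall i, smooth_fun (chi i)) ->
  (forall i, chi i z = 0) ->
  brJ h (fun x => \sum_(i < l) lam i x * chi i x) z =
  \sum_(i < l) lam i z * brJ h (chi i) z.
Proof.
move=> sl sc c0; rewrite brJ_sumr; last by move=> i; exact: (smooth_funM atJ).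
by apply: eq_bigr => i _; rewrite brJMr// c0 mulr0 add0r.
Qed.

Lemma brJ_combl l (lam chi : 'I_l -> J1d E -> R) h z :
  (forall i, smooth_fun (lam i)) -> (forall i, smooth_fun (chi i)) ->
  (forall i, chi i z = 0) ->
  brJ (fun x => \sum_(i < l) lam i x * chi i x) h z =
  \sum_(i < l) lam i z * brJ (chi i) h z.
Proof.
move=> sl sc c0; rewrite brJC brJ_combr// -sumrN.
by apply: eq_bigr => i _; rewrite (brJC (chi i)) mulrN.
Qed.

Lemma ham_vf_vector_field g : smooth_fun g -> is_vector_field (ham_vf g).
Proof.
move=> sg; split=> [f sf|a f h sf sh|f h sf sh].
- exact: smooth_brJ.
- apply/funext => z; rewrite /ham_vf brJDl//; last first.
    by apply: (smooth_funM atJ) => //; exact: (smooth_fun_cst atJ).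
  rewrite brJMl//; last exact: (smooth_fun_cst atJ).
  by rewrite brJ_cstl mul0r add0r.
- by apply/funext => z; rewrite /ham_vf brJMl.
Qed.

Lemma tangent_ham_vf S g z : is_submanifold S -> S z ->
  (forall phi, smooth_fun phi -> vanishes_on S phi -> brJ phi g z = 0) ->
  tangent_at S (ham_vf g) z.
Proof.
move=> subS Sz H.
have [v Hv] := poisson_ddir atJ (fun k => lshift n (rshift 1 k)) (@rshift (1 + n) n) g z.
exact: (@tangent_of_kills _ _ _ atJ _ _ _ v subS Sz Hv H).
Qed.

Lemma tangent_Xh L (h : J1d E -> TE E) S z : ham_section L h -> is_submanifold S -> S z ->
  (forall phi, smooth_fun phi -> vanishes_on S phi -> Xh h phi z = 0) ->
  tangent_at S (Xh h) z.
Proof.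
move=> hh subS Sz H; have [v Hv] := Xh_ddir z hh.
exact: (@tangent_of_kills _ _ _ atJ _ _ _ v subS Sz Hv H).
Qed.

End OnJ1d.

Section Constraints.
Variable L : J1 E -> R.

Lemma SH_sub k : (1 <= k)%N -> SH L k `<=` SH L 1.
Proof.
case: k => // k _; elim: k => [//|k IH] z.
by move=> [Hz _]; exact: IH.
Qed.

Lemma primary_sub (f g : J1d E -> R) : primary L f -> primary L g -> primary L (fun z => f z - g z).
Proof.
move=> [sf f0] [sg g0]; split; first exact: (smooth_funB atJ).
by move=> z Sz; rewrite f0// g0// subrr.
Qed.

Lemma primary_add (f g : J1d E -> R) : primary L f -> primary L g -> primary L (fun z => f z + g z).
Proof.
move=> [sf f0] [sg g0]; split; first exact: (smooth_funD atJ).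
by move=> z Sz; rewrite f0// g0// addr0.
Qed.

Variable Sf : set (J1d E).

Lemma pfcc_sub (f g : J1d E -> R) : pfcc L Sf f -> pfcc L Sf g -> pfcc L Sf (fun z => f z - g z).
Proof.
move=> [pf ff] [pg fg]; split; first exact: primary_sub.
have [sf _] := pf; have [sg _] := pg.
by move=> phi sphi phi0 z Sz; rewrite brJBl// ff// fg// subrr.
Qed.

Lemma pfcc_add (f g : J1d E -> R) : pfcc L Sf f -> pfcc L Sf g -> pfcc L Sf (fun z => f z + g z).
Proof.
move=> [pf ff] [pg fg]; split; first exact: primary_add.
have [sf _] := pf; have [sg _] := pg.
by move=> phi sphi phi0 z Sz; rewrite brJDl// ff// fg// addr0.
Qed.

Lemma pfcc_smooth (f : J1d E -> R) : pfcc L Sf f -> smooth_fun f.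
Proof. by case=> -[]. Qed.

Lemma equiv_pfcc_sub (F G : TE E -> R) : smooth_fun F -> smooth_fun G ->
  equiv_pfcc L Sf F -> equiv_pfcc L Sf G -> equiv_pfcc L Sf (fun a => F a - G a).
Proof.
move=> sF sG [f [pf Ff]] [g [pg Gg]].
exists (fun z => f z - g z); split; first exact: pfcc_sub.
have -> : (fun a => F a - G a - (f (mu a) - g (mu a))) =
    (fun a => (fun a => F a - (f \o mu) a) a - (fun a => G a - (g \o mu) a) a).
  by apply/funext => a /=; ring.
have sfm := smooth_mu (pfcc_smooth pf); have sgm := smooth_mu (pfcc_smooth pg).
move=> a Sa; have [F0 DF] := Ff a Sa; have [G0 DG] := Gg a Sa.
split=> [|v]; first by rewrite /= F0 G0 subrr.
by rewrite (ddirB atT) ?[ddir _ _ _]DF ?DG ?subrr//; exact: (smooth_funB atT).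
Qed.

Lemma equiv_pfcc_add (F G : TE E -> R) : smooth_fun F -> smooth_fun G ->
  equiv_pfcc L Sf F -> equiv_pfcc L Sf G -> equiv_pfcc L Sf (fun a => F a + G a).
Proof.
move=> sF sG [f [pf Ff]] [g [pg Gg]].
exists (fun z => f z + g z); split; first exact: pfcc_add.
have -> : (fun a => F a + G a - (f (mu a) + g (mu a))) =
    (fun a => (fun a => F a - (f \o mu) a) a + (fun a => G a - (g \o mu) a) a).
  by apply/funext => a /=; ring.
have sfm := smooth_mu (pfcc_smooth pf); have sgm := smooth_mu (pfcc_smooth pg).
move=> a Sa; have [F0 DF] := Ff a Sa; have [G0 DG] := Gg a Sa.
split=> [|v]; first by rewrite /= F0 G0 addr0.
by rewrite (ddirD atT) ?[ddir _ _ _]DF ?DG ?addr0//; exact: (smooth_funB atT).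
Qed.

End Constraints.
End Algebra.

(** * Dynamical and Noether symmetries *)

Section Symmetries.
Context {R : realType} {n : nat} (E : fibre_bundle R n) (L : J1 E -> R).
Local Notation mu := (@mu R n E).
Let atT := TE_atlas E.
Let atJ := J1d_atlas E.
Variable G : J1d E -> R.
Hypothesis sG : smooth_fun G.
Let sGm : smooth_fun (G \o mu) := smooth_mu sG.

Lemma smooth_brT_hstar h : ham_section L h -> smooth_fun (brT (G \o mu) (hstar h)).
Proof. by move=> hh; apply: smooth_brT => //; exact: smooth_hstar hh. Qed.

Lemma brT_ham_add h h' psi : ham_section L h -> smooth_fun psi ->
  (forall a, hstar h' a = hstar h a + psi (mu a)) ->
  brT (G \o mu) (hstar h') =
  (fun a => brT (G \o mu) (hstar h) a + brT (G \o mu) (psi \o mu) a).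
Proof.
move=> hh sp Eh; apply/funext => a.
have -> : hstar h' = (fun a => hstar h a + (psi \o mu) a) by exact/funext.
by apply: brTDr; [exact: smooth_hstar hh|exact: smooth_mu].
Qed.

(** X_(h + psi) differs from X_h by the Hamiltonian vector field of psi. There are two
    sets S and S' because a Noether symmetry involves tangency to S_H^1 at the points
    of S_H^2. *)
Lemma tangent_ham_shift S S' h psi : ham_section L h -> primary L psi ->
  is_submanifold S' -> S `<=` S' ->
  (forall z, S z -> tangent_at S' (Xh h) z) ->
  (forall phi, smooth_fun phi -> vanishes_on S' phi -> vanishes_on S (brJ psi phi)) ->
  forall z, S z -> tangent_at S' (Xh (ham_shift h psi)) z.
Proof.
move=> hh pp subS SS th H z Sz; have [sp _] := pp.
have hh' := ham_shift_section hh pp.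
apply: (tangent_Xh hh' subS (SS z Sz)) => phi sphi phi0.
rewrite (Xh_add z hh hh' sp (fun a => hstar_ham_shift psi a hh) sphi).
by rewrite (tangent_kills (th z Sz) sphi phi0) add0r brJC H// oppr0.
Qed.

(** Y_psi is the difference of two vector fields that kill the functions vanishing on
    S' at the points of S. *)
Lemma tangent_ham_diff S S' h h' psi : ham_section L h -> ham_section L h' ->
  smooth_fun psi -> (forall a, hstar h' a = hstar h a + psi (mu a)) ->
  (forall z, S z -> tangent_at S' (Xh h) z) ->
  (forall z, S z -> tangent_at S' (Xh h') z) ->
  forall phi, smooth_fun phi -> vanishes_on S' phi -> vanishes_on S (brJ psi phi).
Proof.
move=> hh hh' sp Eh th th' phi sphi phi0 z Sz.
have := Xh_add z hh hh' sp Eh sphi.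
rewrite (tangent_kills (th z Sz) sphi phi0) (tangent_kills (th' z Sz) sphi phi0).
by rewrite add0r brJC => /eqP; rewrite eq_sym oppr_eq0 => /eqP.
Qed.

Section Dynamical.
Variables (Sf : set (J1d E)) (h0 : J1d E -> TE E).
Hypothesis subSf : is_submanifold Sf.
Hypothesis Sf1 : Sf `<=` SH L 1.
Hypothesis hh0 : ham_section L h0.
Hypothesis th0 : forall z, Sf z -> tangent_at Sf (Xh h0) z.

(** The sections with X_h tangent to Sf are the h0 + psi with psi a pfcc function. *)
Lemma equiv_pfcc_all_sections :
  (forall h, ham_section L h -> (forall z, Sf z -> tangent_at Sf (Xh h) z) ->
     equiv_pfcc L Sf (brT (G \o mu) (hstar h))) <->
  equiv_pfcc L Sf (brT (G \o mu) (hstar h0)) /\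
  (forall psi, pfcc L Sf psi -> equiv_pfcc L Sf (brT (G \o mu) (psi \o mu))).
Proof.
split=> [a|[b1 b2] h hh th].
  have b1 := a h0 hh0 th0; split; first exact: b1.
  move=> psi pp; have [ppsi fpsi] := pp.
  have [sp _] := ppsi.
  have hh' := ham_shift_section hh0 ppsi.
  have th' := tangent_ham_shift hh0 ppsi subSf (@subset_refl _ Sf) th0 fpsi.
  have := equiv_pfcc_sub (smooth_brT_hstar hh') (smooth_brT_hstar hh0) (a _ hh' th') b1.
  rewrite (brT_ham_add hh0 sp (fun a => hstar_ham_shift psi a hh0)).
  congr (equiv_pfcc L Sf _); apply/funext => x.
  by rewrite addrC addKr.
have [psi [pp Eh]] := ham_diff hh hh0; have [sp _] := pp.
rewrite (brT_ham_add hh0 sp Eh); apply: equiv_pfcc_add; last 2 first.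
- exact: b1.
- by apply: b2; split=> //; exact: (tangent_ham_diff hh0 hh sp Eh th0 th).
- exact: smooth_brT_hstar hh0.
- by apply: smooth_brT; [exact: sGm|exact: smooth_mu].
Qed.

Variables (l : nat) (chi : 'I_l -> J1d E -> R).
Hypothesis chi_complete : complete_pfcc L Sf chi.

Let schi i : smooth_fun (chi i).
Proof. exact: pfcc_smooth (cp_pfcc chi_complete i). Qed.

Let chi0 i z : Sf z -> chi i z = 0.
Proof. by move=> Sz; have [[_ p0] _] := cp_pfcc chi_complete i; apply/p0/Sf1. Qed.

(** Strong vanishing is used twice: to replace F by a pfcc function, and this function by
    a combination of the chi, which vanish on S_H^f. *)
Lemma equiv_pfcc_coef F : smooth_fun F -> equiv_pfcc L Sf F ->
  exists lam : 'I_l -> J1d E -> R, (forall i, smooth_fun (lam i)) /\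
    forall f a, smooth_fun f -> Sf (mu a) ->
      brT (f \o mu) F a = \sum_(i < l) lam i (mu a) * brJ f (chi i) (mu a).
Proof.
move=> sF [phi [pp Fphi]]; have sphi := pfcc_smooth pp.
have [lam [slam philam]] := cp_complete chi_complete pp.
exists lam; split=> // f a sf Sa.
have : brT (f \o mu) (fun a => F a - (phi \o mu) a) a = 0 by exact: (poisson_strong _ _ _ Fphi Sa).
rewrite brTBr//; last exact: smooth_mu.
move=> /eqP; rewrite subr_eq0 => /eqP ->; rewrite brT_mu//.
have : brJ f (fun z => phi z - \sum_(i < l) lam i z * chi i z) (mu a) = 0.
  exact: (poisson_strong _ _ _ philam Sa).
rewrite brJBr//; last first.
  by apply: (smooth_fun_sum atJ) => i _; exact: (smooth_funM atJ).
move=> /eqP; rewrite subr_eq0 => /eqP ->; rewrite brJ_combr// => i.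
exact: chi0.
Qed.

Lemma dynamical_symmetry_ham_vf : first_class Sf G ->
  equiv_pfcc L Sf (brT (G \o mu) (hstar h0)) ->
  (forall psi, pfcc L Sf psi -> equiv_pfcc L Sf (brT (G \o mu) (psi \o mu))) ->
  dynamical_symmetry Sf h0 chi (ham_vf G).
Proof.
move=> fG b1 b2; split.
- exact: ham_vf_vector_field.
- move=> z Sz; apply: tangent_ham_vf => // phi sphi phi0.
  by rewrite brJC fG// oppr0.
move=> alpha salpha.
have sh0 := smooth_hstar hh0.
have [lam0 [slam0 lam0E]] := equiv_pfcc_coef (smooth_brT_hstar hh0) b1.
have /choice[lam lamP] : forall i, exists lam : 'I_l -> J1d E -> R,
    (forall j, smooth_fun (lam j)) /\
    forall f a, smooth_fun f -> Sf (mu a) ->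
      brT (f \o mu) (brT (G \o mu) (chi i \o mu)) a =
      \sum_(j < l) lam j (mu a) * brJ f (chi j) (mu a).
  move=> i; apply: equiv_pfcc_coef; last exact: b2 (cp_pfcc chi_complete i).
  by apply: smooth_brT; [exact: sGm|exact: smooth_mu].
exists (fun j z => brJ (alpha j) G z - lam0 j z - \sum_(i < l) alpha i z * lam i j z).
split.
  move=> j; apply: (smooth_funB atJ).
    by apply: (smooth_funB atJ) => //; exact: smooth_brJ.
  apply: (smooth_fun_sum atJ) => i _; apply: (smooth_funM atJ) => //.
  by have [] := lamP i.
move=> f sf z Sz; pose a := h0 z; have az : mu a = z by exact: (hs_section hh0).
have sfm := smooth_mu sf.
(* The two commutators [Y_G, X_h0] and [Y_G, Y_chi], computed at the point a of
   the fibre over z. *)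
have C1 : brJ (Xh h0 f) G z - Xh h0 (brJ f G) z =
    - \sum_(j < l) lam0 j z * brJ f (chi j) z.
  have sX := smooth_Xh hh0 sf.
  have X1 : Xh h0 f \o mu = brT (f \o mu) (hstar h0).
    by apply/funext => x; exact: esym (brT_hstar x hh0 sf).
  have X2 : brJ f G \o mu = brT (f \o mu) (G \o mu).
    by apply/funext => x; exact: esym (brT_mu x sf sG).
  have := lam0E f a sf; rewrite az => /(_ Sz) <-.
  rewrite -(brT_commutator a sfm sGm sh0) -X1 -X2 (brT_mu a sX sG).
  by rewrite (brT_hstar a hh0 (smooth_brJ sf sG)) az.
have C2 i : brJ (brJ f (chi i)) G z - brJ (brJ f G) (chi i) z =
    - \sum_(j < l) lam i j z * brJ f (chi j) z.
  have X1 : brJ f (chi i) \o mu = brT (f \o mu) (chi i \o mu).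
    by apply/funext => x; exact: esym (brT_mu x sf (schi i)).
  have X2 : brJ f G \o mu = brT (f \o mu) (G \o mu).
    by apply/funext => x; exact: esym (brT_mu x sf sG).
  have [_ lamE] := lamP i; have := lamE f a sf; rewrite az => /(_ Sz) <-.
  rewrite -(brT_commutator a sfm sGm (smooth_mu (schi i))) -X1 -X2.
  by rewrite (brT_mu a (smooth_brJ sf (schi i)) sG) (brT_mu a (smooth_brJ sf sG) (schi i)) az.
have sfc i : smooth_fun (brJ f (chi i)) by exact: smooth_brJ.
rewrite /lie_bracket {1}/ham_vf /dynamics /ham_vf.
rewrite brJDl; [|exact: smooth_Xh hh0 sf|]; last first.
  by apply: (smooth_fun_sum atJ) => i _; exact: (smooth_funM atJ).
rewrite (brJ_suml (F := fun i x => alpha i x * brJ f (chi i) x)); last first.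
  by move=> i; exact: (smooth_funM atJ).
rewrite opprD addrACA C1 -sumrB.
have -> : \sum_(i < l) (brJ (fun x => alpha i x * brJ f (chi i) x) G z -
     alpha i z * brJ (brJ f G) (chi i) z) =
   \sum_(i < l) brJ (alpha i) G z * brJ f (chi i) z -
   \sum_(j < l) (\sum_(i < l) alpha i z * lam i j z) * brJ f (chi j) z.
  under [X in _ = _ - X]eq_bigr do rewrite mulr_suml.
  rewrite exchange_big /= -sumrB; apply: eq_bigr => i _.
  rewrite brJMl// -addrA -mulrBr C2 mulrN; congr (_ - _).
  by rewrite [LHS]mulr_sumr; apply: eq_bigr => j _; rewrite mulrA.
rewrite addrA [- _ + _]addrC -!sumrB; apply: eq_bigr => j _.
by rewrite !mulrBl.
Qed.

End Dynamical.

(** A different pfcc^1 function is used at each point z of S_H^2: it agrees to first order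
    at z with the difference of two sections. *)
Lemma noether_condition m (phi : 'I_m -> J1d E -> R) h0 :
  complete_constraints (SH L 1) phi ->
  is_submanifold (SH L 1) ->
  (exists r : nat, forall z, SH L 1 z ->
     \rank (\matrix_(a < m, b < m) brJ (phi a) (phi b) z) = r) ->
  ham_section L h0 ->
  (forall z, SH L 2 z -> tangent_at (SH L 1) (Xh h0) z) ->
  (vanishes_on (mu @^-1` SH L 2) (brT (G \o mu) (hstar h0)) /\
   (forall psi, pfcc1 L psi ->
      vanishes_on (mu @^-1` SH L 2) (brT (G \o mu) (psi \o mu))))
  <-> noether_symmetry L G.
Proof.
move=> phiC sub1 [r rC] hh0 th0.
have S21 : SH L 2 `<=` SH L 1 by exact: SH_sub.
split=> [[b1 b2] h hh th|H]; last first.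
  have b1 := H h0 hh0 th0; split; first exact: b1.
  move=> psi [pp fpsi] a Sa.
  have [sp _] := pp.
  have hh' := ham_shift_section hh0 pp.
  have th' : forall z, SH L 2 z -> tangent_at (SH L 1) (Xh (ham_shift h0 psi)) z.
    apply: tangent_ham_shift => // chi schi chi0 z Sz.
    by apply: (fpsi chi (conj schi chi0)); exact: S21.
  have := H _ hh' th' a Sa.
  rewrite (brT_ham_add hh0 sp (fun a => hstar_ham_shift psi a hh0)).
  by rewrite (b1 a Sa) add0r.
have [psi [pp Eh]] := ham_diff hh hh0; have [sp psi0] := pp.
have fpsi := tangent_ham_diff hh0 hh sp Eh th0 th.
move=> a Sa; rewrite (brT_ham_add hh0 sp Eh) (b1 a Sa) add0r.
have [lam [slam psiE]] := cc_complete phiC sp psi0.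
have sphi := cc_smooth phiC.
have phi0 i z : SH L 1 z -> phi i z = 0 by rewrite (cc_zeros phiC); exact.
pose C z := \matrix_(i < m, j < m) brJ (phi i) (phi j) z.
have sC i j : smooth_fun (fun z => C z i j).
  have -> : (fun z => C z i j) = brJ (phi i) (phi j) by apply/funext => z; rewrite mxE.
  exact: smooth_brJ.
pose z := mu a; have S1z : SH L 1 z by exact: S21.
(* The coefficients of psi at z lie in the kernel of C z, because psi commutes
   at z with every primary constraint. *)
have vC : (\row_i lam i z) *m C z = 0.
  apply/rowP => j; rewrite [RHS]mxE -[RHS](fpsi (phi j) (sphi j) (fun w => phi0 j w) z Sa).
  rewrite mxE psiE brJ_combl//; last by move=> i; exact: phi0.
  by apply: eq_bigr => i _; rewrite !mxE.
have [kappa [skappa kC kz]] := kernel_extension atJ sC rC S1z vC.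
(* psi' replaces psi: it has the same coefficients as psi at z, and its
   brackets with primary constraints vanish on all of S_H^1. *)
pose psi' w := \sum_(i < m) kappa w 0 i * phi i w.
have sk i : smooth_fun (fun w => kappa w 0 i) by exact: skappa.
have spsi' : smooth_fun psi'.
  by apply: (smooth_fun_sum atJ) => i _; exact: (smooth_funM atJ).
have p1 : pfcc1 L psi'.
  split.
    by split=> // w Sw; apply: big1 => i _; rewrite phi0// mulr0.
  move=> chi [schi chi0] w Sw.
  have [nu [snu ->]] := cc_complete phiC schi chi0.
  rewrite brJ_combr//; last by move=> i; exact: phi0.
  apply: big1 => j _; rewrite /psi' (brJ_combl (lam := fun i w => kappa w 0 i))//; last first.
    by move=> i; exact: phi0.
  have := kC w Sw => /(congr1 (fun u : 'rV[R]_m => u 0 j)); rewrite !mxE => kj.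
  rewrite -[X in _ * X](_ : \sum_i kappa w 0 i * C w i j = _); last first.
    by apply: eq_bigr => i _; rewrite mxE.
  by rewrite kj mulr0.
rewrite -(b2 psi' p1 a Sa) !brT_mu// -/z psiE /psi'.
rewrite brJ_combr//; last by move=> i; exact: phi0.
rewrite (brJ_combr (lam := fun i w => kappa w 0 i))//; last by move=> i; exact: phi0.
by apply: eq_bigr => i _; rewrite kz mxE.
Qed.

End Symmetries.

Theorem theorem18 (R : realType) (n : nat) (E : fibre_bundle R n)
    (L : J1 E -> R) (hc : J1d E -> TE E)
    (m : nat) (phi : 'I_m -> J1d E -> R) (f : nat) (G : J1d E -> R)
    (L_smooth : smooth_fun L)
    (* L admits a Hamiltonian section *)
    (hc_section : ham_section L hc)
    (* a complete set of independent primary constraints *)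
    (phi_complete : complete_constraints (SH L 1) phi)
    (* the constraint sets are submanifolds, and the algorithm ends at step f *)
    (SH_submanifold : forall k, (1 <= k)%N -> is_submanifold (SH L k))
    (f_pos : (1 <= f)%N)
    (f_final : SH L f.+1 = SH L f)
    (* constant rank assumptions *)
    (FL_rank : exists r : nat, forall z : J1 E, map_rank (FL L) z = r)
    (bracket_rank : forall (k : nat) (l : nat) (chi : 'I_l -> J1d E -> R),
       (1 <= k)%N -> complete_constraints (SH L k) chi ->
       exists r : nat, forall z, SH L k z ->
         \rank (\matrix_(a < m, b < l) brJ (phi a) (chi b) z) = r)
    (G_smooth : smooth_fun G)
    (G_first_class : first_class (SH L f) G) :
  (forall h0 : J1d E -> TE E,
     ham_section L h0 ->
     (forall z, SH L f z -> tangent_at (SH L f) (Xh h0) z) ->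
     let a :=
       forall h, ham_section L h ->
         (forall z, SH L f z -> tangent_at (SH L f) (Xh h) z) ->
         equiv_pfcc L (SH L f) (brT (G \o @mu R n E) (hstar h)) in
     let b :=
       equiv_pfcc L (SH L f) (brT (G \o @mu R n E) (hstar h0)) /\
       (forall psi, pfcc L (SH L f) psi ->
         equiv_pfcc L (SH L f) (brT (G \o @mu R n E) (psi \o @mu R n E))) in
     (a <-> b) /\
     (a -> forall (l : nat) (chi : 'I_l -> J1d E -> R),
         complete_pfcc L (SH L f) chi ->
         dynamical_symmetry (SH L f) h0 chi (ham_vf G)))
  /\
  (forall h0 : J1d E -> TE E,
     ham_section L h0 ->
     (forall z, SH L 2 z -> tangent_at (SH L 1) (Xh h0) z) ->
     (vanishes_on (@mu R n E @^-1` SH L 2) (brT (G \o @mu R n E) (hstar h0)) /\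
      (forall psi, pfcc1 L psi ->
         vanishes_on (@mu R n E @^-1` SH L 2)
           (brT (G \o @mu R n E) (psi \o @mu R n E))))
     <-> noether_symmetry L G).
Proof.
split=> h0 hh0 th0.
  move=> a b; have ab : a <-> b := equiv_pfcc_all_sections G_smooth (SH_submanifold f f_pos) hh0 th0.
  split=> // Ha l chi cchi; have [b1 b2] := ab.1 Ha.
  exact: (dynamical_symmetry_ham_vf G_smooth (SH_submanifold f f_pos)
    (SH_sub f_pos) hh0 cchi G_first_class b1 b2).
exact: (noether_condition G_smooth phi_complete (SH_submanifold 1%N isT)
  (bracket_rank 1%N m phi isT phi_complete) hh0 th0).
Qed.
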